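(* Let $C$ be a nonempty convex subset of $X$, let $F\colon X\to Y\cup\{+\infty_Y\}$ be a proper $K$-convex mapping, and let $G\colon X\to Z\cup\{+\infty_Z\}$ be a proper $S$-convex mapping. Let $A:=C\cap G^{-1}(-S)$ and $E:=G(C\cap\operatorname{dom}F\cap\operatorname{dom}G)+S$. Assume that $A\cap\operatorname{dom}F\neq\emptyset$ and that one of the following conditions holds: $(c_1)$ there exists $\bar x\in C\cap\operatorname{dom}F$ such that $G(\bar x)\in-\operatorname{int}S$; $(c_2)$ $X,Z$ are Fréchet spaces, $C$ is closed, $y^*\circ F$ is lower semicontinuous for all $y^*\in Y^*$, $G$ is $S$-epi closed and $0_Z\in\operatorname{sqri}E$; $(c_3)$ $\dim\operatorname{lin}E<+\infty$ and $0_Z\in\operatorname{ri}E$. Then for all $(L,y)\in\mathcal{L}(X,Y)\times Y$ the following assertions are equivalent: $(b_1)$ for all $x$: if $x\in C$ and $G(x)\in-S$, then $F(x)-L(x)+y\notin-\operatorname{int}K$; $(b_2)$ there exists $T\in\mathcal{L}_+(S,K)$ such that $F(x)+(T\circ G)(x)-L(x)+y\notin-\operatorname{int}K$ for all $x\in C$.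
   Context: $X,Y,Z$ are (real) locally convex Hausdorff topological vector spaces with topological duals $X^*,Y^*,Z^*$; $K\subset Y$ is a closed, pointed, convex cone with $\operatorname{int}K\neq\emptyset$; $S\subset Z$ is a nonempty closed convex cone. $Y$ is enlarged by a greatest element $+\infty_Y\notin Y$ and a smallest element $-\infty_Y\notin Y$, $Y^\bullet:=Y\cup\{-\infty_Y,+\infty_Y\}$, with $(+\infty_Y)+y=y+(+\infty_Y)=+\infty_Y$ for $y\in Y\cup\{+\infty_Y\}$ (so $+\infty_Y\notin-\operatorname{int}K$). Analogously $+\infty_Z$ is a greatest element attached to $Z$ (ordered by $S$). For $F\colon X\to Y^\bullet$, $\operatorname{dom}F=\{x\in X: F(x)\neq+\infty_Y\}$; $F$ is proper if $\operatorname{dom}F\neq\emptyset$ and $-\infty_Y\notin F(X)$; $\operatorname{epi}_KF=\{(x,y)\in X\times Y: y\in F(x)+K\}$; $F$ is $K$-convex if $\operatorname{epi}_KF$ is convex, and $K$-epi closed if it is closed. The same notions are used for $G$ with $(Z,S)$ in place of $(Y,K)$. For $y^*\in Y^*$, $(y^*\circ F)(x)=y^*(F(x))$ if $F(x)\in Y$ and $+\infty$ if $F(x)=+\infty_Y$. $\mathcal{L}(X,Y)$ is the space of continuous linear mappings $X\to Y$. For $T\in\mathcal{L}(Z,Y)$, $(T\circ G)(x)=T(G(x))$ if $G(x)\in Z$ and $+\infty_Y$ if $G(x)=+\infty_Z$. $\mathcal{L}_+(S,K)=\{T\in\mathcal{L}(Z,Y): T(S)\subset K\}$. For a convex set $U$: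 $\operatorname{lin}U$ is its linear hull, $\operatorname{ri}U$ its relative interior (interior relative to its affine hull), and $\operatorname{sqri}U$ its strong quasi-relative interior, i.e. the set of $u\in U$ such that the cone $\bigcup_{\lambda\ge 0}\lambda(U-u)$ is a closed linear subspace. *)

(* Defs.v *)
From mathcomp Require Export all_boot all_order all_algebra.
From mathcomp Require Export all_classical all_reals all_analysis.

Set Implicit Arguments.
Unset Strict Implicit.
Unset Printing Implicit Defensive.

Export Order.TTheory GRing.Theory Num.Theory.
Export numFieldNormedType.Exports.

Global Open Scope classical_set_scope.
Global Open Scope ring_scope.

(** [option V] stands for V extended with a greatest element +oo, the latter
    being [None]; the value -oo never occurs.  A subset A of V is the subset
    [Some @` A] of [option V], so that +oo belongs to no such set. *)

Section extended_values.
Context {V : zmodType}.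

Definition eadd (u v : option V) : option V :=
  if u is Some a then if v is Some b then Some (a + b) else None else None.

Definition einset (A : set V) : set (option V) := Some @` A.

Definition setN (A : set V) : set V := -%R @` A.

End extended_values.

Notation "u +^ v" := (eadd u v) (at level 50, left associativity).

Section cones_and_hulls.
Context {R : realType}.

Definition is_cone (V : lmodType R) (K : set V) :=
  forall (l : R) x, 0 <= l -> K x -> K (l *: x).

Definition is_pointed (V : lmodType R) (K : set V) := K `&` setN K = [set 0].

Definition linear_subspace (V : lmodType R) (M : set V) :=
  submod_closed (mem M).

Definition affine_set (V : lmodType R) (M : set V) :=
  forall (t : R) x y, M x -> M y -> M (t *: x + (1 - t) *: y).

Definition linear_hull (V : lmodType R) (U : set V) : set V :=
  smallest (@linear_subspace V) U.

Definition affine_hull (V : lmodType R) (U : set V) : set V :=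
  smallest (@affine_set V) U.

Definition finite_dimensional (V : lmodType R) (M : set V) :=
  exists2 B : set V, finite_set B & M = linear_hull B.

Definition ri (V : tvsType R) (U : set V) : set V :=
  [set u | U u /\ within (affine_hull U) (nbhs u) U].

Definition cone_at (V : lmodType R) (U : set V) (u : V) : set V :=
  [set l *: (w - u) | l in [set l : R | 0 <= l] & w in U].

Definition sqri (V : tvsType R) (U : set V) : set V :=
  [set u | [/\ U u, closed (cone_at U u) & linear_subspace (cone_at U u)]].

Definition is_metric (V : Type) (d : V -> V -> R) :=
  [/\ forall x y, d x y = 0 <-> x = y,
      forall x y, d x y = d y x &
      forall x y z, d x z <= d x y + d y z].

Definition metric_cauchy (V : Type) (d : V -> V -> R) (u : nat -> V) :=
  forall e : R, 0 < e ->
    exists N, forall m n, (N <= m)%N -> (N <= n)%N -> d (u m) (u n) < e.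

(** The topology is induced by a complete translation-invariant metric; local
    convexity is part of [tvsType].  Completeness is not stated through the
    library's complete uniform spaces because the uniformity of a [tvsType] is
    only required to induce the topology, not to be translation-invariant. *)
Definition frechet_space (V : tvsType R) :=
  exists d : V -> V -> R,
    [/\ is_metric d,
        forall x y z, d (x + z) (y + z) = d x y,
        forall (x : V) (A : set V), nbhs x A <->
          exists2 e : R, 0 < e & [set y | d x y < e] `<=` A &
        forall u : nat -> V, metric_cauchy d u ->
          exists l : V, u @ \oo --> l].

End cones_and_hulls.

Section vector_mappings.
Context {R : realType}.

Definition edom (X V : Type) (F : X -> option V) : set X :=
  [set x | F x <> None].

Definition proper (X V : Type) (F : X -> option V) := edom F !=set0.

Definition epigraph (X V : lmodType R) (K : set V) (F : X -> option V) :
    set (X * V) :=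
  [set p | exists v k, [/\ F p.1 = Some v, K k & p.2 = v + k]].

Definition cone_convex (X V : lmodType R) (K : set V) (F : X -> option V) :=
  convex_set (epigraph K F).

Definition epi_closed (X V : tvsType R) (K : set V) (F : X -> option V) :=
  closed (epigraph K F).

(** y^* o F for a functional y^*, as an extended real-valued function. *)
Definition scalarization (X : Type) (Y : lmodType R)
    (ys : {linear Y -> R^o}) (F : X -> option Y) (x : X) : \bar R :=
  if F x is Some v then (ys v)%:E else +oo%E.

Definition linear_comp (X : Type) (Z Y : lmodType R)
    (T : {linear Z -> Y}) (G : X -> option Z) (x : X) : option Y :=
  if G x is Some z then Some (T z) else None.

Definition positive_operators (Z Y : tvsType R) (S : set Z) (K : set Y) :
    set {linear Z -> Y} :=
  [set T | continuous T /\ T @` S `<=` K].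

Definition feasible_set (X : Type) (Z : zmodType)
    (C : set X) (G : X -> option Z) (S : set Z) : set X :=
  C `&` G @^-1` einset (setN S).

Definition constraint_image (X : Type) (Y : Type) (Z : zmodType)
    (C : set X) (F : X -> option Y) (G : X -> option Z) (S : set Z) : set Z :=
  [set z + s | z in [set z | (G @` (C `&` edom F `&` edom G)) (Some z)]
             & s in S].

End vector_mappings.

(* Main.v *)
Require Import Defs.
From HB Require Import structures.
From mathcomp Require Import ring lra.

Set Implicit Arguments.
Unset Strict Implicit.
Unset Printing Implicit Defensive.

(** This is Lagrange duality for a convex vector problem.  The operator [T] is
    built as [T z = f z *: k0] from an interior point [k0] of [K] and a scalar
    multiplier [f], so everything reduces to scalar duality.

    The objective is scalarized first.  The values [F x - L x + y] at feasible
    [x] form a set that is convex up to adding elements of [K] and that misses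
    [- K°]; separating it from [- K°] ([cone_scalarization]) gives a continuous
    functional [h], nonnegative on [K] with [h k0 = 1], whose value at
    [F x - L x + y] is nonnegative for every feasible [x].

    Now perturb the constraint to [G x <= z] for the order of [S], and let
    [v z] be the infimum of [h (F x - L x + y)] under it.  This [v] is convex,
    [v 0 >= 0], and its domain is the set [E] of the theorem.  A multiplier is a
    continuous [f] with [v + f >= 0]; it exists as soon as [v] is bounded above
    near [0] on a subspace [M] containing [E] ([multiplier]): the epigraph of
    [v] is then separated from an open cone below it.  Since [E + S] is
    contained in [E], such an [f] is nonnegative on [S], whence [T] maps [S]
    into [K]; and [h (F x + T (G x) - L x + y) >= 0] on [C], whereas [h] is
    negative on [- K°].

    Each regularity condition serves to bound [v].  Under the Slater condition
    the point [xbar] is admissible for all small perturbations.  In the two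
    other cases a sublevel set of [v] is convex and absorbing in [M], and has to
    be a neighbourhood of [0] in [M].  In finite dimension this holds because a
    finite-dimensional subspace of a Hausdorff space is the range of a
    continuous projection [finite_rank_projection].  In Frechet spaces the
    sublevel set is the projection to [Z] of a closed convex subset of [X * Z],
    and the claim is the Robinson-Ursescu theorem ([robinson_ursescu]), which rests on
    Baire's argument ([frechet_barrel]) and on the completeness of [X].

    The separation statements all come from [positive_functional], an algebraic
    Hahn-Banach theorem for cones obtained from Zorn's lemma; continuity of the
    functional follows from a bound on a neighbourhood. *)

(** * Deciding linear identities in a module *)

Section linear_expressions.
Context {R : realType} {V : lmodType R}.

Inductive lexpr :=
  | LVar of nat
  | LZero
  | LAdd of lexpr & lexpr
  | LOpp of lexpr
  | LScale of R & lexpr.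

Fixpoint leval (env : seq V) (e : lexpr) : V :=
  match e with
  | LVar i => nth 0 env i
  | LZero => 0
  | LAdd a b => leval env a + leval env b
  | LOpp a => - leval env a
  | LScale r a => r *: leval env a
  end.

Fixpoint lcoef (i : nat) (e : lexpr) : R :=
  match e with
  | LVar j => if Nat.eqb i j then 1 else 0
  | LZero => 0
  | LAdd a b => lcoef i a + lcoef i b
  | LOpp a => - lcoef i a
  | LScale r a => r * lcoef i a
  end.

Fixpoint same_coefs (n : nat) (a b : lexpr) : Prop :=
  if n is n'.+1 then lcoef n' a = lcoef n' b /\ same_coefs n' a b else True.

Lemma leval_coefs (env : seq V) (e : lexpr) :
  leval env e = \sum_(i < size env) lcoef i e *: nth 0 env i.
Proof.
elim: e => [j||a IHa b IHb|a IHa|r a IHa] /=.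
- have [jn|jn] := ltnP j (size env).
    rewrite (bigD1 (Ordinal jn)) //= PeanoNat.Nat.eqb_refl scale1r.
    rewrite big1 ?addr0 // => i ij.
    case: (PeanoNat.Nat.eqb_spec i j) => [eij|_]; last by rewrite scale0r.
    by case/eqP: ij; exact: val_inj.
  rewrite nth_default // big1 // => i _.
  case: (PeanoNat.Nat.eqb_spec i j) => [eij|_]; last by rewrite scale0r.
  by have := ltn_ord i; rewrite eij ltnNge jn.
- by rewrite big1 // => i _; rewrite scale0r.
- by rewrite IHa IHb -big_split; apply: eq_bigr => i _; rewrite scalerDl.
- by rewrite IHa -sumrN; apply: eq_bigr => i _; rewrite scaleNr.
- by rewrite IHa scaler_sumr; apply: eq_bigr => i _; rewrite scalerA.
Qed.

(** A linear combination is determined by its coefficients, so a vector identity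
    reduces to finitely many scalar ones, which the scalar tactics can handle. *)
Lemma leval_eq (env : seq V) (a b : lexpr) :
  same_coefs (size env) a b -> leval env a = leval env b.
Proof.
move=> h; rewrite !leval_coefs; apply: eq_bigr => -[i /= ilt] _; congr (_ *: _).
elim: (size env) h i ilt => [//|n IHn] /= [hn h] i.
by rewrite ltnS leq_eqVlt => /predU1P[->//|]; exact: IHn.
Qed.

End linear_expressions.

(** Fails when [x] is not in [env]; [latoms] uses this failure as a membership
    test. *)
Ltac latom_index env x :=
  lazymatch env with
  | x :: _ => constr:(0%N)
  | _ :: ?env' => let n := latom_index env' x in constr:(S n)
  end.

Ltac latoms env t :=
  lazymatch t with
  | ?a + ?b => let env' := latoms env a in latoms env' b
  | - ?a => latoms env a
  | _ *: ?a => latoms env a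
  | 0 => env
  | _ => match goal with
         | _ => let n := latom_index env t in env
         | _ => constr:(t :: env)
         end
  end.

Ltac lreify R env t :=
  lazymatch t with
  | ?a + ?b => let a' := lreify R env a in
               let b' := lreify R env b in constr:(@LAdd R a' b')
  | - ?a => let a' := lreify R env a in constr:(@LOpp R a')
  | ?r *: ?a => let a' := lreify R env a in constr:(@LScale R r a')
  | 0 => constr:(@LZero R)
  | _ => let n := latom_index env t in constr:(@LVar R n)
  end.

Ltac lmodule_with R V :=
  lazymatch goal with
  | |- @eq _ ?a ?b =>
    let env := latoms (@nil V) a in
    let env := latoms env b in
    let a' := lreify R env a in
    let b' := lreify R env b in
    change (@leval R V env a' = @leval R V env b');
    apply: leval_eq; simpl; repeat split
  end.

(** Reduces an identity between linear combinations of vectors of [V] to the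
    identities between the scalar coefficients of each vector. *)
Ltac lmodule R V := lmodule_with R V; try ring.

(** * Positive functionals on cones *)

Section linear_functional.
Context {R : realType} {V W : lmodType R}.

Lemma linear_fun_of (f : V -> W) :
  (forall x y, f (x + y) = f x + f y) -> (forall t x, f (t *: x) = t *: f x) ->
  exists g : {linear V -> W}, forall x, g x = f x.
Proof.
move=> fD fZ.
have flin : linear f by move=> t x y; rewrite fD fZ.
pose m := GRing.isLinear.Build _ _ _ _ f flin.
by exists (HB.pack_for {linear V -> W} f m).
Qed.

Lemma functionalZ (f : {linear V -> R^o}) (t : R) x : f (t *: x) = t * f x.
Proof. exact: linearZ. Qed.

End linear_functional.

Section positive_functional.
Context {R : realType} {V : lmodType R}.
Implicit Types (W : set V) (e x y : V).

Definition convex_cone W :=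
  is_cone W /\ forall x y, W x -> W y -> W (x + y).

Definition core_point W e := forall x, exists2 t : R, 0 < t & W (e + t *: x).

(** A cone that is maximal among those avoiding [- e] is total: if it contained
    neither [x] nor [- x], adjoining either one would produce [- e], and the two
    resulting equations combine to put [- e] in the cone itself. *)
Lemma maximal_cone W e : convex_cone W -> core_point W e -> ~ W (- e) ->
  exists W', [/\ W `<=` W', convex_cone W', ~ W' (- e) &
                 forall x, W' x \/ W' (- x)].
Proof.
move=> [Wc WD] We WNe.
have W0 : W 0.
  by have [t _ /(Wc 0 _ (lexx _))] := We 0; rewrite scale0r.
(* Uniting with [W] makes the empty chain harmless. *)
pose P U := convex_cone (W `|` U) /\ ~ (W `|` U) (- e).
have [F FP Ftot|U [[[Uc UD] UNe] Umax]] := @Zorn_bigcup V P.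
  have inW x X : F X -> (W `|` X) x -> (W `|` \bigcup_(Y in F) Y) x.
    by move=> FX [Wx|Xx]; [left|right; exists X].
  split; first split.
  - move=> t x t0 [Wx|[X FX Xx]]; first by left; exact: Wc.
    by apply: (inW _ _ FX); have [[c _] _] := FP _ FX; apply: c => //; right.
  - have add X x y : F X -> (W `|` X) x -> (W `|` X) y ->
        (W `|` \bigcup_(Y in F) Y) (x + y).
      by move=> FX Xx Xy; apply: (inW _ _ FX); have [[_ c] _] := FP _ FX; exact: c.
    move=> x y [Wx|[X FX Xx]] [Wy|[Y FY Yy]].
    + by left; exact: WD.
    + by apply: (add _ _ _ FY); [left|right].
    + by apply: (add _ _ _ FX); [right|left].
    + have [XY|YX] := Ftot _ _ FX FY.
        by apply: (add _ _ _ FY); right=> //; exact: XY.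
      by apply: (add _ _ _ FX); right=> //; exact: YX.
  - by move=> [//|[X FX Xe]]; have [_ []] := FP _ FX; right.
pose M := W `|` U; exists M; split=> //; first by move=> x; left.
have M0 : M 0 by left.
have adjoin x : ~ M x -> exists2 l : R, 0 < l & exists2 w, M w & - e = w + l *: x.
  move=> Mx; pose N := [set w + l *: x | w in M & l in [set l : R | 0 <= l]].
  have MN : M `<=` N.
    by move=> w Mw; exists w => //; exists 0; rewrite /= ?scale0r ?addr0.
  have Nx : N x by exists 0 => //; exists 1; rewrite /= ?ler01 // scale1r add0r.
  have NE : W `|` N = N.
    by apply/seteqP; split=> [z [Wz|//]|z]; [apply: MN; left|right].
  have UN : U `<` N.
    split=> [z Uz|NU]; first by apply: MN; right.
    by apply: Mx; right; exact: NU.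
  have : N (- e).
    apply/not_notP => NNe; apply: (Umax _ UN); split; rewrite NE //; split.
      move=> t _ t0 [w Mw [l l0 <-]]; exists (t *: w); first exact: Uc.
      exists (t * l); first by rewrite /= mulr_ge0.
      lmodule R V.
    move=> _ _ [w Mw [l /= l0 <-]] [w' Mw' [l' /= l0' <-]].
    exists (w + w'); first exact: UD.
    exists (l + l'); first by rewrite /= addr_ge0.
    lmodule R V.
  move=> [w Mw [l /= l0 ewl]]; exists l; last by exists w.
  rewrite lt_neqAle l0 andbT eq_sym; apply/eqP => l_0; apply: UNe.
  by rewrite -ewl l_0 scale0r addr0.
move=> x; have [Mx|/adjoin [l l0 [w Mw ew]]] := pselect (M x); first by left.
have [Mx|/adjoin [l' l0' [w' Mw' ew']]] := pselect (M (- x)); first by right.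
exfalso; apply: UNe.
have -> : - e = (l + l')^-1 *: (l' *: w + l *: w').
  have -> : w = - e - l *: x by rewrite ew addrK.
  have -> : w' = - e - l' *: (- x) by rewrite ew' addrK.
  lmodule R V; field; lra.
apply: (Uc); first by rewrite invr_ge0; lra.
by apply: (UD); apply: (Uc) => //; exact: ltW.
Qed.

(** For a total cone [M] with order unit [e], each [x] cuts the line [R e] at a
    single real [f x]: above it [t *: e] dominates [x], below it [x] dominates
    [t *: e].  The cut is linear in [x] because it is unique. *)
Lemma positive_functional W e : convex_cone W -> core_point W e -> ~ W (- e) ->
  exists2 f : {linear V -> R^o}, forall x, W x -> 0 <= f x & f e = 1.
Proof.
move=> WC We WNe; have [M [WM [Mc MD] MNe Mtot]] := maximal_cone WC We WNe.
have Me : M e by have [t _ /WM] := We 0; rewrite scaler0 addr0.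
have MeP t : M (t *: e) <-> 0 <= t.
  split=> [Mt|t0]; last exact: Mc.
  rewrite leNgt; apply/negP => t0; apply: MNe.
  have -> : - e = (- t)^-1 *: (t *: e) by lmodule R V; field; lra.
  by apply: (Mc) => //; rewrite invr_ge0; lra.
have cut x : exists r : R, forall t, (M (t *: e - x) -> r <= t) /\
                              (M (x - t *: e) -> t <= r).
  pose T := [set t : R | M (t *: e - x)].
  have Tne : T !=set0.
    have [t t0 /WM Mt] := We (- x); exists t^-1; rewrite /T /=.
    have -> : t^-1 *: e - x = t^-1 *: (e + t *: - x) by lmodule R V; field; lra.
    by apply: (Mc) => //; rewrite invr_ge0 ltW.
  have cmp s t : M (s *: e - x) -> M (x - t *: e) -> t <= s.
    move=> Ms Mt; rewrite -subr_ge0; apply/MeP.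
    have -> : (s - t) *: e = (s *: e - x) + (x - t *: e) by lmodule R V.
    exact: MD.
  have Tlb : has_lbound T.
    have [t t0 /WM Mt] := We x; exists (- t^-1) => s Ts; apply: cmp Ts _.
    have -> : x - - t^-1 *: e = t^-1 *: (e + t *: x) by lmodule R V; field; lra.
    by apply: (Mc) => //; rewrite invr_ge0 ltW.
  exists (inf T) => t; split=> [Mt|Mt]; first exact: ge_inf.
  by apply: lb_le_inf => // s Ts; exact: cmp Ts Mt.
have [f fP] := choice cut.
have above x t : f x < t -> M (t *: e - x).
  move=> ft; have [//|Mt] := Mtot (t *: e - x).
  have [_] := fP x t; rewrite -[x - _]opprB => /(_ Mt); lra.
have below x t : t < f x -> M (x - t *: e).
  move=> ft; have [//|Mt] := Mtot (x - t *: e).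
  have [] := fP x t; rewrite -[_ - x]opprB => /(_ Mt); lra.
have funiq x r : (forall t, r < t -> M (t *: e - x)) ->
    (forall t, t < r -> M (x - t *: e)) -> f x = r.
  move=> ra rb; apply/eqP; rewrite eq_le; apply/andP; split.
    by apply/ler_addgt0Pr => d d0; apply: (fP x _).1; apply: ra; lra.
  rewrite -[f x]opprK -[r]opprK lerN2; apply/ler_addgt0Pr => d d0.
  suff : r - d <= f x by lra.
  by apply: (fP x _).2; apply: rb; lra.
have fD x y : f (x + y) = f x + f y.
  apply: funiq => t ht.
    pose d := (t - f x - f y) / 2.
    have -> : t *: e - (x + y) = ((f x + d) *: e - x) + ((f y + d) *: e - y).
      by rewrite /d; lmodule R V; field.
    by apply: (MD); apply: above; rewrite /d; lra.
  pose d := (f x + f y - t) / 2.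
  have -> : (x + y) - t *: e = (x - (f x - d) *: e) + (y - (f y - d) *: e).
    by rewrite /d; lmodule R V; field.
  by apply: (MD); apply: below; rewrite /d; lra.
have fN x : f (- x) = - f x.
  apply: funiq => t ht.
    have -> : t *: e - - x = x - (- t) *: e by lmodule R V.
    by apply: below; lra.
  have -> : - x - t *: e = (- t) *: e - x by lmodule R V.
  by apply: above; lra.
have fZp s x : 0 < s -> f (s *: x) = s * f x.
  move=> s0; apply: funiq => t ht.
    have -> : t *: e - s *: x = s *: ((t / s) *: e - x) by lmodule R V; field; lra.
    by apply: (Mc); [exact: ltW|apply: above; rewrite ltr_pdivlMr // mulrC].
  have -> : s *: x - t *: e = s *: (x - (t / s) *: e) by lmodule R V; field; lra.
  by apply: (Mc); [exact: ltW|apply: below; rewrite ltr_pdivrMr // mulrC].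
have fZ (s : R) x : f (s *: x) = s *: (f x : R^o).
  have [s0|s0|->] := ltgtP s 0; last 2 first.
  - exact: fZp.
  - have f0 : f 0 = 0 by have := fD 0 0; rewrite addr0; lra.
    by rewrite !scale0r f0.
  rewrite -[s]opprK scaleNr fN fZp; last lra.
  by rewrite scaleNr.
have [g gf] := @linear_fun_of _ V R^o f fD fZ; exists g => [x Wx|].
  rewrite gf; apply: (fP x 0).2; rewrite scale0r subr0; exact: WM.
rewrite gf; apply: funiq => t ht.
  have -> : t *: e - e = (t - 1) *: e by lmodule R V.
  by apply: Mc => //; lra.
have -> : e - t *: e = (1 - t) *: e by lmodule R V.
by apply: Mc => //; lra.
Qed.

End positive_functional.

(** * Convex sets and neighbourhoods of the origin *)

Section convex_sets.
Context {R : realType} {V : lmodType R}.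

Lemma convex_setP (A : set V) : convex_set A <->
  forall x y (t : R), 0 <= t -> t <= 1 -> A x -> A y ->
    A (t *: x + (1 - t) *: y).
Proof.
split=> [cA x y t t0 t1 Ax Ay|cA x y l /set_mem Ax /set_mem Ay].
  by have /set_mem := cA x y (Itv01 t0 t1) (mem_set Ax) (mem_set Ay).
by apply/mem_set; apply: (cA).
Qed.

Lemma convex_setI (A B : set V) :
  convex_set A -> convex_set B -> convex_set (A `&` B).
Proof.
move=> /convex_setP cA /convex_setP cB; apply/convex_setP => x y t t0 t1.
by move=> [Ax Bx] [Ay By]; split; [exact: cA|exact: cB].
Qed.

Lemma convex_set_opp (A : set V) : convex_set A -> convex_set [set x | A (- x)].
Proof.
move=> /convex_setP cA; apply/convex_setP => x y t t0 t1 /= Ax Ay.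
have -> : - (t *: x + (1 - t) *: y) = t *: - x + (1 - t) *: - y by lmodule R V.
exact: cA.
Qed.

Lemma convex_set_shrink (A : set V) x (t : R) :
  convex_set A -> A 0 -> A x -> 0 <= t -> t <= 1 -> A (t *: x).
Proof.
move=> /convex_setP cA A0 Ax t0 t1.
have -> : t *: x = t *: x + (1 - t) *: 0 by lmodule R V.
exact: cA.
Qed.

Lemma convex_merge (A : set V) x y (a b : R) :
  convex_set A -> A x -> A y -> 0 <= a -> 0 <= b ->
  exists2 z, A z & a *: x + b *: y = (a + b) *: z.
Proof.
move=> /convex_setP cA Ax Ay a0 b0.
have [ab0|ab0] := eqVneq (a + b) 0.
  have [-> ->] : a = 0 /\ b = 0 by split; lra.
  by exists x => //; lmodule R V.
have ab : 0 < a + b by rewrite lt_neqAle eq_sym ab0 addr_ge0.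
exists ((a / (a + b)) *: x + (1 - a / (a + b)) *: y); last by lmodule R V; field.
apply: cA => //; first by rewrite divr_ge0 // ltW.
by rewrite ler_pdivrMr // mul1r lerDl.
Qed.

End convex_sets.

Section tvs.
Context {R : realType} {V : tvsType R}.
Implicit Types (U A : set V) (x : V).

Lemma nbhs_scale_small U x : nbhs 0 U ->
  exists2 r : R, 0 < r & forall t : R, `|t| < r -> U (t *: x).
Proof.
move=> U0; have /= := @scale_continuous R V (0, x) U.
rewrite scale0r => /(_ U0) [[A B] /= [[r /= r0 rA] Bx] AB].
exists r => // t tr; apply: (AB (t, x)); split; last exact: nbhs_singleton.
by apply: rA; rewrite /ball_ /= sub0r normrN.
Qed.

Lemma scale_fixed_continuous (t : R) : continuous (fun x : V => t *: x).
Proof.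
move=> x; apply: (@continuous_comp _ _ _ (fun x : V => (t : R^o, x))
  (fun p : R^o * V => p.1 *: p.2)); last exact: scale_continuous.
by apply: (@cvg_pair _ _ _ _ (nbhs (t : R^o))); [exact: cvg_cst|exact: cvg_id].
Qed.

Lemma translate_continuous (a : V) : continuous (fun x : V => a + x).
Proof.
move=> x; apply: (@continuous_comp _ _ _ (fun x => (a, x))
  (fun p : V * V => p.1 + p.2)); last exact: add_continuous.
by apply: cvg_pair => /=; [exact: cvg_cst|exact: cvg_id].
Qed.

Lemma nbhs0_opp U : nbhs 0 U -> nbhs 0 [set x | U (- x)].
Proof.
by move=> U0; have := @opp_continuous V 0 U; rewrite oppr0 => /(_ U0).
Qed.

Lemma nbhs0_scale U (t : R) : nbhs 0 U -> nbhs 0 [set x | U (t *: x)].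
Proof.
by move=> U0; have := @scale_fixed_continuous t 0 U; rewrite scaler0 => /(_ U0).
Qed.

Lemma nbhs_translate U x : nbhs x U <-> nbhs 0 [set y | U (x + y)].
Proof.
split=> [Ux|Ux].
  by have := @translate_continuous x 0 U; rewrite addr0 => /(_ Ux).
have := @translate_continuous (- x) x [set y | U (x + y)]; rewrite addNr => /(_ Ux).
apply: (@filterS _ (nbhs x) _ (fun y => U (x + (- x + y)))) => y.
by rewrite addrA subrr add0r.
Qed.

Lemma nbhs0_convex_sym U : nbhs 0 U -> exists U',
  [/\ nbhs 0 U', convex_set U', forall x, U' x -> U' (- x) & U' `<=` U].
Proof.
move=> U0; have [B Bc [Bo Bb]] := @locally_convex R V.
have [A [BA A0] AU] := Bb 0 U U0.
have nA : nbhs 0 A by apply: open_nbhs_nbhs; split=> //; exact: Bo.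
exists (A `&` [set x | A (- x)]); split.
- by apply: filterI => //; exact: nbhs0_opp.
- by apply: convex_setI; [|apply: convex_set_opp]; apply: Bc; exact: mem_set.
- by move=> x [Ax ANx]; split; rewrite /= ?opprK.
- by move=> x [/AU].
Qed.

(** A lower bound on a symmetric neighbourhood is also an upper bound; scaling the
    neighbourhood then makes the functional small. *)
Lemma functional_continuous (f : {linear V -> R^o}) (c : R) :
  nbhs 0 [set x | c <= f x] -> continuous f.
Proof.
move=> fc x; apply/cvgrPdist_lt => e e0.
have [U [U0 _ Usym Uc]] := nbhs0_convex_sym fc.
pose d := `|c| + 1; have d0 : 0 < d by rewrite /d ltr_pwDr.
have bound y : U y -> `|f y| < d.
  move=> Uy; have := Uc _ Uy; have := Uc _ (Usym _ Uy); rewrite /= linearN.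
  move=> h1 h2; rewrite ltr_norml /d; have := ler_norm (- c); rewrite normrN.
  by move=> h3; apply/andP; split; lra.
have : nbhs x [set y | U ((d / e) *: (y - x))].
  apply/nbhs_translate; apply: filterS (nbhs0_scale (d / e) U0) => y /=.
  by rewrite [x + y]addrC addrK.
apply: filterS => y /bound; rewrite linearZ linearB /= normrM.
rewrite ger0_norm ?divr_ge0 ?ltW // -ltr_pdivlMl ?divr_gt0 //.
by rewrite distrC invf_div divfK ?gt_eqF.
Qed.

(** With [U] a convex symmetric neighbourhood of [0] missing [x], the cone spanned
    by [x + U] does not contain [- x]. *)
Lemma separate_point x : hausdorff_space V -> x != 0 ->
  exists2 f : {linear V -> R^o}, continuous f & f x = 1.
Proof.
move=> hV x0.
have [U0 nU0 U0x] : exists2 U, nbhs 0 U & ~ U x.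
  apply/not_notP => h; case/eqP: x0; apply/esym; apply: hV => A B A0 Bx.
  have [Ax|nAx] := pselect (A x); last by case: h; exists A.
  by exists x; split=> //; exact: nbhs_singleton.
have [U [nU Uc Usym UU0]] := nbhs0_convex_sym nU0.
have Uz : U 0 by exact: nbhs_singleton.
pose W := [set l *: (x + u) | l in [set l : R | 0 <= l] & u in U].
have [|||f fW fx] := @positive_functional R V W x.
- split=> [t _ t0 [l /= l0 [u Uu <-]]|].
    by exists (t * l); rewrite /= ?mulr_ge0 //; exists u; rewrite ?scalerA.
  move=> _ _ [l /= l0 [u Uu <-]] [m /= m0 [v Uv <-]].
  have [w Uw lmE] := convex_merge Uc Uu Uv l0 m0.
  exists (l + m); rewrite /= ?addr_ge0 //; exists w => //.
  have -> : (l + m) *: (x + w) = (l + m) *: x + (l + m) *: w by lmodule R V.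
  by rewrite -lmE; lmodule R V.
- move=> y; have [r r0 rU] := nbhs_scale_small y nU; exists (r / 2); first lra.
  exists 1; rewrite /= ?ler01 //; exists ((r / 2) *: y); rewrite ?scale1r //.
  by apply: rU; rewrite ger0_norm; lra.
- move=> [l /= l0 [u Uu xE]]; apply: U0x; apply: UU0.
  have -> : x = (l / (1 + l)) *: (- u).
    (* The equation exhibits [x] as a contraction of the element [- u] of [U]. *)
    have xl : (1 + l) *: x = l *: - u.
      transitivity (x + l *: (x + u) - l *: u); first by lmodule R V.
      by rewrite xE; lmodule R V.
    rewrite mulrC -scalerA -xl.
    by lmodule R V; field; lra.
  apply: convex_set_shrink => //; first exact: Usym.
    by rewrite divr_ge0 //; lra.
  by rewrite ler_pdivrMr; lra.
exists f => //; apply: (@functional_continuous _ (-1)).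
apply: filterS nU => u Uu /=.
suff : 0 <= f (x + u) by rewrite linearD fx; lra.
by apply: fW; exists 1; rewrite /= ?ler01 //; exists u; rewrite ?scale1r.
Qed.

End tvs.

Section linear_subspaces.
Context {R : realType} {V : lmodType R}.
Implicit Types (M : set V).

Lemma subspace0 M : linear_subspace M -> M 0.
Proof. by move=> [/set_mem]. Qed.

Lemma subspaceD M x y : linear_subspace M -> M x -> M y -> M (x + y).
Proof.
move=> [_ h] Mx My; have /set_mem := h 1 x y (mem_set Mx) (mem_set My).
by rewrite scale1r.
Qed.

Lemma subspaceZ M (t : R) x : linear_subspace M -> M x -> M (t *: x).
Proof.
move=> [M0 h] Mx; have /set_mem := h t x 0 (mem_set Mx) M0.
by rewrite addr0.
Qed.

End linear_subspaces.

(** * Frechet spaces *)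

Lemma half_pow_small (R : realType) (e : R) : 0 < e ->
  exists N, (1 / 2 : R) ^+ N < e.
Proof.
move=> e0; have half1 : `|1 / 2 : R| < 1 by rewrite ger0_norm; lra.
have /cvgrPdist_lt/(_ _ e0)[N _ NP] := cvg_expr half1.
exists N; have := NP N (leqnn _); rewrite /= sub0r normrN ger0_norm //.
Qed.

Section invariant_metric.
Context {R : realType} {V : tvsType R} {d : V -> V -> R}.
Hypothesis dm : is_metric d.
Hypothesis dT : forall x y z, d (x + z) (y + z) = d x y.
Hypothesis dn : forall x A, nbhs x A <->
  exists2 e : R, 0 < e & [set y | d x y < e] `<=` A.

Lemma metric_refl x : d x x = 0.
Proof. by have [d0 _ _] := dm; apply/d0. Qed.

Lemma metric_sym x y : d x y = d y x.
Proof. by have [_ + _] := dm; apply. Qed.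

Lemma metric_triangle y x z : d x z <= d x y + d y z.
Proof. by have [_ _ +] := dm; apply. Qed.

Lemma metric_ge0 x y : 0 <= d x y.
Proof.
by have := metric_triangle y x x; rewrite metric_refl (metric_sym y x); lra.
Qed.

Lemma metric_sub x y : d x y = d 0 (y - x).
Proof. by rewrite -(dT x y (- x)) subrr. Qed.

Lemma nbhs_metric_ball x (e : R) : 0 < e -> nbhs x [set y | d x y < e].
Proof. by move=> e0; apply/dn; exists e. Qed.

Lemma nbhs0_metric_opp e x : d 0 x < e -> d 0 (- x) < e.
Proof. by rewrite -(dT 0 (- x) x) addNr add0r metric_sym. Qed.

Lemma geometric_cauchy (u : nat -> V) :
  (forall n, d (u n) (u n.+1) <= (1 / 2) ^+ n) -> metric_cauchy d u.
Proof.
move=> du; have far n k : d (u n) (u (n + k)%N) <= 2 * (1 / 2) ^+ n.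
  have : d (u n) (u (n + k)%N) <= 2 * (1 / 2) ^+ n * (1 - (1 / 2) ^+ k).
    elim: k => [|k IHk]; first by rewrite addn0 metric_refl expr0 subrr mulr0.
    apply: le_trans (metric_triangle (u (n + k)%N) _ _) _.
    have := du (n + k)%N; rewrite -addnS exprD [_ ^+ k.+1]exprS.
    by move: IHk; set p := _ ^+ n; set q := _ ^+ k; lra.
  have : 0 <= (1 / 2 : R) ^+ n * (1 / 2) ^+ k.
    by rewrite mulr_ge0 // exprn_ge0 //; lra.
  lra.
move=> e e0.
have [|N Ne] := @half_pow_small R (e / 4); first lra.
exists N => m n Nm Nn.
have := metric_triangle (u N) (u m) (u n).
have := far N (m - N)%N; have := far N (n - N)%N; rewrite !subnKC //.
rewrite (metric_sym (u m) (u N)); lra.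
Qed.

Lemma cvg_of_metric (u : nat -> V) (l : V) :
  (forall e : R, 0 < e -> exists N, forall n, (N <= n)%N -> d l (u n) < e) ->
  u @ \oo --> l.
Proof.
move=> h A /dn [e e0 eA]; have [N NP] := h e e0.
by exists N => // n /= Nn; apply: eA; exact: NP.
Qed.

Lemma metric_of_cvg (u : nat -> V) (l : V) : u @ \oo --> l ->
  forall e : R, 0 < e -> exists N, forall n, (N <= n)%N -> d l (u n) < e.
Proof.
move=> h e e0; have /= := h _ (nbhs_metric_ball l e0).
by move=> [N _ NP]; exists N => n Nn; exact: NP.
Qed.

End invariant_metric.


Lemma closure_convex {R : realType} {V : tvsType R} (A : set V) :
  convex_set A -> convex_set (closure A).
Proof.
move=> /convex_setP cA; apply/convex_setP => x y t t0 t1 Ax Ay U nU.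
have cont : continuous (fun p : V * V => t *: p.1 + (1 - t) *: p.2).
  move=> p; apply: (@continuous_comp _ _ _
    (fun p : V * V => (t *: p.1, (1 - t) *: p.2)) (fun p : V * V => p.1 + p.2));
    last exact: add_continuous.
  apply: cvg_pair => /=.
    apply: (@continuous_comp _ _ _ fst); first exact: cvg_fst.
    exact: scale_fixed_continuous.
  apply: (@continuous_comp _ _ _ snd); first exact: cvg_snd.
  exact: scale_fixed_continuous.
have [[B C] /= [Bx Cy] BC] := cont (x, y) U nU.
have [x' [Ax' Bx']] := Ax _ Bx; have [y' [Ay' Cy']] := Ay _ Cy.
by exists (t *: x' + (1 - t) *: y'); split; [exact: cA|exact: (BC (x', y'))].
Qed.

Lemma dependent_choice_seq (T : Type) (good : nat -> T -> Prop)
    (step : nat -> T -> T -> Prop) (a : T) : good 0%N a ->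
  (forall n x, good n x -> exists y, good n.+1 y /\ step n x y) ->
  exists u : nat -> T, [/\ u 0%N = a, forall n, good n (u n) &
                           forall n, step n (u n) (u n.+1)].
Proof.
move=> ga next.
have /choice[f fP] : forall p : nat * T, exists y,
    good p.1 p.2 -> good p.1.+1 y /\ step p.1 p.2 y.
  move=> [n x]; have [/(next n)[y yP]|?] := pselect (good n x); first by exists y.
  by exists x.
pose u := fix u n := if n is n'.+1 then f (n', u n') else a.
have gu n : good n (u n) by elim: n => // n IHn; exact: (fP (n, u n) IHn).1.
by exists u; split=> // n; exact: (fP (n, u n) (gu n)).2.
Qed.

Section frechet.
Context {R : realType} {V : tvsType R}.
Hypothesis hV : frechet_space V.

(** Baire's argument.  If [D] were not a neighbourhood of [0] in [M], no ball of
    [M] would lie in a multiple of [D], since [D] is convex and symmetric.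
    Shrinking balls that avoid [D], [2 D], [3 D], and so on then close down on a
    point of [M] that lies in no multiple of [D]. *)
Lemma frechet_barrel (M D : set V) : closed M -> linear_subspace M ->
  closed D -> convex_set D -> (forall x, D x -> D (- x)) ->
  (forall x, M x -> exists2 t : R, 0 < t & D (t *: x)) ->
  within M (nbhs 0) D.
Proof.
move=> Mcl Msub Dcl Dcv Dsym Dabs; have [d [dm dT dn dcomp]] := hV.
apply/not_notP => nD.
have M0 := subspace0 Msub.
have D0 : D 0 by have [t _] := Dabs _ M0; rewrite scaler0.
have escape n z (r : R) : M z -> 0 < r ->
    exists2 z', M z' & d z z' < r /\ ~ D (n.+1%:R^-1 *: z').
  move=> Mz r0; apply/not_notP => h; apply: nD.
  have ball_in w : M w -> d 0 w < r -> D (n.+1%:R^-1 *: (z + w)).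
    move=> Mw wr; apply/not_notP => nDw; apply: h; exists (z + w).
      exact: subspaceD.
    by split; rewrite // (metric_sub dT) addrC addKr.
  have : nbhs 0 [set w | d 0 (n.+1%:R *: w) < r].
    apply: (@nbhs0_scale _ _ [set w | d 0 w < r]).
    exact: nbhs_metric_ball.
  rewrite /within /=; apply: filterS => w wr Mw.
  have Mw' := subspaceZ n.+1%:R Msub Mw.
  have h1 := ball_in _ Mw' wr.
  have /Dsym h2 : D (n.+1%:R^-1 *: (z - n.+1%:R *: w)).
    apply: ball_in; last exact: nbhs0_metric_opp.
    by rewrite -scaleN1r; exact: subspaceZ.
  (* Averaging a translate with the opposite of its mirror image removes [z]. *)
  have -> : w = (1 / 2) *: (n.+1%:R^-1 *: (z + n.+1%:R *: w)) +
      (1 - 1 / 2) *: - (n.+1%:R^-1 *: (z - n.+1%:R *: w)).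
    by lmodule R V; field; have := ler0n R n; lra.
  by move/convex_setP: Dcv; apply=> //; lra.
pose good (p : V * R) := M p.1 /\ 0 < p.2.
pose step n (p q : V * R) := [/\ q.2 <= p.2 / 2, d p.1 q.1 <= p.2 / 2 &
  forall w, d q.1 w <= q.2 -> ~ D (n.+1%:R^-1 *: w)].
have [|n [z r] [/= Mz r0]|u [u0 gu su]] :=
    @dependent_choice_seq _ (fun=> good) step (0, 1).
- by split=> //=; exact: ltr01.
- have [|z' Mz' [zz' nDz']] := escape n z (r / 2) Mz; first lra.
  have /dn[e e0 eD] : nbhs z' [set w | ~ D (n.+1%:R^-1 *: w)].
    apply: (@scale_fixed_continuous _ _ n.+1%:R^-1 z' (~` D)).
    by apply: open_nbhs_nbhs; split=> //; exact: closed_openC.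
  exists (z', Num.min (e / 2) (r / 2)); split.
    by split; rewrite //= lt_min; apply/andP; split; lra.
  split=> /=; first by rewrite ge_min lexx orbT.
    exact: ltW.
  move=> w; rewrite le_min => /andP[we _]; apply: eD => /=; lra.
have r_small n : (u n).2 <= (1 / 2) ^+ n.
  elim: n => [|n IHn]; first by rewrite u0 expr0.
  by have [h _ _] := su n; rewrite exprS; lra.
have nested n k : d (u n).1 (u (n + k)%N).1 <= (u n).2 - (u (n + k)%N).2.
  elim: k => [|k IHk]; first by rewrite addn0 (metric_refl dm) subrr.
  have [h1 h2 _] := su (n + k)%N; rewrite addnS.
  have := metric_triangle dm (u (n + k)%N).1 (u n).1 (u (n + k).+1).1; lra.
have uc : metric_cauchy d (fun n => (u n).1).
  apply: (geometric_cauchy dm) => n.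
  by have [_ h _] := su n; have := r_small n; have [_] := gu n; lra.
have [l ul] := dcomp _ uc.
have Ml : M l.
  have uM : \forall n \near \oo, M (u n).1 by apply: nearW => n; exact: (gu n).1.
  exact: (closed_cvg M Mcl uM l ul).
have in_ball n : d (u n).1 l <= (u n).2.
  apply/ler_addgt0Pr => e e0.
  have [N /(_ (n + N)%N (leq_addl _ _))] := metric_of_cvg dn ul e0.
  rewrite (metric_sym dm) => h; have := nested n N; have [_] := gu (n + N)%N.
  have := metric_triangle dm (u (n + N)%N).1 (u n).1 l; lra.
have [t t0 Dt] := Dabs l Ml.
have [n nt] : exists n, n.+1%:R^-1 <= t.
  exists (Num.truncn t^-1); rewrite invf_ple ?posrE //.
  by apply/ltW/truncnS_gt.
have [_ _ /(_ l (in_ball n.+1))] := su n; apply.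
have -> : n.+1%:R^-1 *: l = (n.+1%:R^-1 / t) *: (t *: l).
  by lmodule R V; field; have := ler0n R n; lra.
apply: convex_set_shrink => //; first by rewrite divr_ge0 // ltW.
by rewrite ler_pdivrMr // mul1r.
Qed.

End frechet.

(** The Robinson-Ursescu theorem.  Let [B n] be the image of the part of [Gamma]
    over [x0 + U n], with [U n] shrinking geometrically.  The closure of [B n] is
    a neighbourhood of [0] in [M] by Baire.  The closure is removed by successive
    approximation: [z] is written as the sum of [2^-(n+1) *: w n] with [w n] in
    [B n], and the corresponding convex series of preimages converges by
    completeness of [X] to a preimage of [z]. *)
Lemma robinson_ursescu {R : realType} {X Z : tvsType R} (Gamma : set (X * Z))
    (M : set Z) (x0 : X) :
  frechet_space X -> frechet_space Z -> closed Gamma -> convex_set Gamma ->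
  closed M -> linear_subspace M -> (forall x z, Gamma (x, z) -> M z) ->
  Gamma (x0, 0) ->
  (forall z, M z -> exists2 t : R, 0 < t & exists x, Gamma (x, t *: z)) ->
  within M (nbhs 0) [set z | exists x, Gamma (x, z)].
Proof.
move=> fX fZ Gcl /convex_setP Gcv Mcl Msub GM G0 Gabs.
have [dX [mX tX nX cX]] := fX; have [dZ [mZ tZ nZ cZ]] := fZ.
have half_gt0 n : 0 < (1 / 2 : R) ^+ n by rewrite exprn_gt0 //; lra.
have half_le1 n : (1 / 2 : R) ^+ n <= 1 by rewrite exprn_ile1 //; lra.
have /choice[U UP] : forall n, exists U : set X, [/\ nbhs 0 U, convex_set U &
    forall x, U x -> dX 0 x < (1 / 2) ^+ n].
  move=> n; have /nbhs0_convex_sym[U [U0 Uc _ Ud]] :=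
    nbhs_metric_ball nX 0 (half_gt0 n).
  by exists U; split.
have U0 n : U n 0 by have [/nbhs_singleton] := UP n.
pose B n := [set z | exists2 u, U n u & Gamma (x0 + u, z)].
have B0 n : B n 0 by exists 0 => //; rewrite addr0.
have BM n z : B n z -> M z by move=> [u _ /GM].
have Bcv n : convex_set (B n).
  apply/convex_setP => z z' t t0 t1 [u Uu Gu] [u' Uu' Gu'].
  have [_ /convex_setP Uc _] := UP n.
  exists (t *: u + (1 - t) *: u'); first exact: Uc.
  have -> : x0 + (t *: u + (1 - t) *: u') =
            t *: (x0 + u) + (1 - t) *: (x0 + u') by lmodule R X.
  exact: Gcv Gu Gu'.
have Babs n z : M z -> exists2 t : R, 0 < t & B n (t *: z).
  move=> Mz; have [t t0 [x Gx]] := Gabs _ Mz; have [nU _ _] := UP n.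
  have [r r0 rU] := nbhs_scale_small (x - x0) nU.
  pose s := Num.min 1 (r / 2).
  have s0 : 0 < s by rewrite lt_min ltr01; lra.
  have s1 : s <= 1 by rewrite ge_min lexx.
  have sr : s < r by rewrite /s gt_min; apply/orP; right; lra.
  exists (s * t); first exact: mulr_gt0.
  exists (s *: (x - x0)); first by apply: rU; rewrite gtr0_norm.
  have -> : x0 + s *: (x - x0) = s *: x + (1 - s) *: x0 by lmodule R X.
  have -> : (s * t) *: z = s *: (t *: z) + (1 - s) *: 0 by lmodule R Z.
  exact: Gcv (ltW s0) s1 Gx G0.
have clB n : within M (nbhs 0) (closure (B n)).
  have clB0 : closure (B n) 0 by exact: subset_closure.
  have clcv := closure_convex (Bcv n).
  suff : within M (nbhs 0) (closure (B n) `&` [set z | closure (B n) (- z)]).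
    by apply: filterS => z [].
  apply: (frechet_barrel fZ) => //.
  - apply: closedI; first exact: closed_closure.
    apply: (@closed_comp _ _ (@GRing.opp Z)) => [z _|]; last exact: closed_closure.
    exact: opp_continuous.
  - by apply: convex_setI => //; exact: convex_set_opp.
  - by move=> z [h1 h2]; split; rewrite /= ?opprK.
  - move=> z Mz; have [s s0 /subset_closure sz] := Babs n z Mz.
    have [t t0 /subset_closure tz] := Babs n _ (subspaceZ (-1) Msub Mz).
    pose m := Num.min s t; have m0 : 0 < m by rewrite lt_min s0.
    exists m => //; split.
      have -> : m *: z = (m / s) *: (s *: z) by lmodule R Z; field; lra.
      apply: convex_set_shrink => //; first by rewrite divr_ge0 // ltW.
      by rewrite ler_pdivrMr // mul1r ge_min lexx.
    have /= -> : - (m *: z) = (m / t) *: (t *: (-1 *: z)) by lmodule R Z; field; lra.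
    apply: convex_set_shrink => //; first by rewrite divr_ge0 // ltW.
    by rewrite ler_pdivrMr // mul1r ge_min lexx orbT.
have /choice[V VP] : forall n, exists V : set Z, [/\ nbhs 0 V,
    forall z (t : R), V z -> 0 <= t -> t <= 1 -> V (t *: z),
    forall z, V z -> M z -> closure (B n) z &
    forall z, V z -> dZ 0 (- z) < (1 / 2) ^+ n].
  move=> n; have clBn : nbhs 0 [set z | M z -> closure (B n) z] := clB n.
  have nb := nbhs_metric_ball nZ 0 (half_gt0 n).
  have [V [V0 Vc Vs Vsub]] := nbhs0_convex_sym (filterI clBn nb).
  exists V; split=> //.
  - by move=> z t Vz; apply: convex_set_shrink => //; exact: nbhs_singleton.
  - by move=> z /Vsub[h _]; exact: h.
  - by move=> z /Vs /Vsub[].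
have V0n : nbhs 0 [set z | V 0%N (2 *: z)].
  by apply: nbhs0_scale; have [] := VP 0%N.
rewrite /within /=; apply: filterS V0n => z V2z Mz.
(* The state at stage [n] is the partial sum in [X] together with the rescaled
   residual [2^(n+1) *: (z - partial sum)], which stays in [V n]. *)
pose good n (s : X * Z) := V n s.2 /\ M s.2.
pose step n (s s' : X * Z) := exists u w, [/\ U n u, Gamma (x0 + u, w) &
  s' = (s.1 + (1 / 2) ^+ n.+1 *: u, 2 *: (s.2 - w))].
have [|n [a y] [/= Vy My]|s [s0 gs ss]] :=
    @dependent_choice_seq _ good step (0, 2 *: z).
- by split=> //=; exact: subspaceZ.
- have [V1 _ _ _] := VP n.+1; have [_ _ /(_ y Vy My) clBy _] := VP n.
  have [|w [[u Uu Gu] /= Vw]] := clBy [set w | V n.+1 (2 *: (y - w))].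
    apply/nbhs_translate; apply: filterS (nbhs0_scale (-2) V1) => h /=.
    by have -> : 2 *: (y - (y + h)) = -2 *: h by lmodule R Z.
  exists (a + (1 / 2) ^+ n.+1 *: u, 2 *: (y - w)); split; last by exists u, w.
  split=> //=; apply: subspaceZ => //; apply: subspaceD => //.
  by rewrite -scaleN1r; apply: subspaceZ => //; exact: GM Gu.
(* A partial sum has total weight [1 - 2^-n]; the invariant says that spending
   the remaining weight on any point of the graph gives a point of the graph. *)
have inv n u w : Gamma (x0 + u, w) -> Gamma (x0 + ((s n).1 + (1 / 2) ^+ n *: u),
    z - (1 / 2) ^+ n.+1 *: (s n).2 + (1 / 2) ^+ n *: w).
  elim: n u w => [|n IHn] u w Gu.
    rewrite s0 /= expr0 expr1 add0r scale1r.
    by have -> : z - (1 / 2) *: (2 *: z) + 1 *: w = w by lmodule R Z; field.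
  have [u' [w' [_ Gu' ->]]] := ss n.
  have mid : Gamma (x0 + ((1 / 2) *: u' + (1 - 1 / 2) *: u),
                    (1 / 2) *: w' + (1 - 1 / 2) *: w).
    have -> : x0 + ((1 / 2) *: u' + (1 - 1 / 2) *: u) =
              (1 / 2) *: (x0 + u') + (1 - 1 / 2) *: (x0 + u) by lmodule R X.
    by apply: (Gcv (x0 + u', w') (x0 + u, w)) => //; lra.
  move: (IHn _ _ mid) => /=; congr (Gamma (x0 + _, _)).
    by rewrite exprS; lmodule R X; field.
  by rewrite !exprS; lmodule R Z; field.
have aC : metric_cauchy dX (fun n => (s n).1).
  apply: (geometric_cauchy mX) => n; have [u [w [Uu _ ->]]] := ss n.
  rewrite (metric_sub tX) /= addrC addKr.
  have [_ Uc Ud] := UP n; apply: ltW; apply: Ud.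
  by apply: convex_set_shrink => //; exact: ltW.
have [a sa] := cX _ aC; exists (x0 + a).
have sz : (fun n => z - (1 / 2) ^+ n.+1 *: (s n).2) @ \oo --> z.
  apply: (cvg_of_metric nZ) => e e0; have [N Ne] := half_pow_small e0.
  exists N => n Nn; rewrite (metric_sub tZ) addrC addKr.
  have [_ Vs _ Vd] := VP n; have [Vn _] := gs n.
  apply: le_lt_trans Ne; apply: le_trans (_ : (1 / 2) ^+ n <= _).
    by apply/ltW/Vd/Vs => //; exact: ltW.
  by apply: ler_wiXn2l => //; lra.
have sxa : (fun n => x0 + (s n).1) @ \oo --> x0 + a.
  by apply: (continuous_cvg _ (@translate_continuous _ _ x0 a)).
have ev : \forall n \near \oo,
    Gamma (x0 + (s n).1, z - (1 / 2) ^+ n.+1 *: (s n).2).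
  apply: nearW => n; have := inv n 0 0; rewrite addr0 => /(_ G0).
  by rewrite !scaler0 !addr0.
exact: (closed_cvg Gamma Gcl ev (x0 + a, z) (cvg_pair sxa sz)).
Qed.

(** * Linear hulls and finite-dimensional subspaces *)

Section hulls.
Context {R : realType} {V : lmodType R}.
Implicit Types (M U : set V).

Lemma subspaceP M : M 0 -> (forall (t : R) x y, M x -> M y -> M (t *: x + y)) ->
  linear_subspace M.
Proof.
move=> M0 h; split; first exact: mem_set.
by move=> t x y /set_mem Mx /set_mem My; apply: mem_set; exact: h.
Qed.

Lemma linear_hull_subspace U : linear_subspace (linear_hull U).
Proof.
apply: subspaceP => [M [/subspace0]|t x y hx hy M [Ms UM]] //.
apply: subspaceD => //; first by apply: subspaceZ => //; exact: hx.
exact: hy.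
Qed.

Lemma sub_linear_hull U : U `<=` linear_hull U.
Proof. exact: sub_gen_smallest. Qed.

Lemma linear_hull_mono U U' : U `<=` U' -> linear_hull U `<=` linear_hull U'.
Proof.
move=> UU'; apply: smallest_sub; first exact: linear_hull_subspace.
exact: subset_trans UU' (@sub_linear_hull _).
Qed.

Lemma linear_hull_cons a (s : seq V) z : linear_hull [set` a :: s] z ->
  exists c : R, exists2 w, linear_hull [set` s] w & z = c *: a + w.
Proof.
pose N := [set z | exists c : R, exists2 w, linear_hull [set` s] w & z = c *: a + w].
suff : linear_hull [set` a :: s] `<=` N by exact.
apply: smallest_sub.
  have Ss := @linear_hull_subspace [set` s].
  apply: subspaceP.
    by exists 0, 0; rewrite ?scale0r ?addr0 //; exact: (subspace0 Ss).
  move=> t _ _ [c [w hw ->]] [c' [w' hw' ->]].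
  exists (t * c + c'), (t *: w + w'); last by lmodule R V.
  by apply: (subspaceD Ss) => //; exact: (subspaceZ _ Ss).
move=> u; rewrite /= inE => /predU1P[->|us].
  exists 1, 0; first exact: (subspace0 (@linear_hull_subspace _)).
  by rewrite scale1r addr0.
by exists 0, u; [exact: sub_linear_hull|rewrite scale0r add0r].
Qed.

(** An affine set through the origin is a linear subspace. *)
Lemma linear_hull_sub_affine U : U 0 -> linear_hull U `<=` affine_hull U.
Proof.
move=> U0; have aff : affine_set (affine_hull U).
  move=> t x y hx hy M [Ma UM].
  by apply: (Ma); [exact: hx|exact: hy].
have A0 : affine_hull U 0 by move=> M [_]; exact.
apply: smallest_sub; last exact: sub_gen_smallest.
apply: subspaceP => // t x y Ax Ay.
have -> : t *: x + y = 2 *: ((1 / 2) *: (t *: x + (1 - t) *: 0) +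
   (1 - 1 / 2) *: y) + (1 - 2) *: 0 by lmodule R V; field.
by apply: (aff) => //; apply: (aff) => //; exact: (aff).
Qed.

End hulls.

Section finite_rank.
Context {R : realType} {Z : tvsType R}.
Implicit Types (M : set Z) (P : Z -> Z).

(** Maps [z |-> \sum_i f_i z *: a_i] with continuous [f_i] and with [a_i] in [M],
    presented inductively so that no list of functionals has to be handled. *)
Inductive finite_rank M : (Z -> Z) -> Prop :=
| FiniteRank0 : finite_rank M (fun=> 0)
| FiniteRankD (f : {linear Z -> R^o}) a P : continuous f -> M a ->
    finite_rank M P -> finite_rank M (fun z => f z *: a + P z).

Lemma finite_rank_mono M M' P : M `<=` M' -> finite_rank M P -> finite_rank M' P.
Proof.
move=> MM'; elim=> [|f a Q fc Ma _ IH]; first exact: FiniteRank0.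
by apply: FiniteRankD => //; exact: MM'.
Qed.

Lemma finite_rank_mem M P z : linear_subspace M -> finite_rank M P -> M (P z).
Proof.
move=> Ms; elim=> [|f a Q fc Ma _ IH]; first exact: subspace0.
by apply: subspaceD => //; exact: subspaceZ.
Qed.

Lemma finite_rank_linear M P t x y : finite_rank M P ->
  P (t *: x + y) = t *: P x + P y.
Proof.
elim=> [|f a Q fc Ma _ IH] /=; first by lmodule R Z.
by rewrite IH linearP /=; lmodule R Z; rewrite /GRing.scale /=; ring.
Qed.

Lemma finite_rank_residual M P (psi : {linear Z -> R^o}) :
  continuous psi -> finite_rank M P ->
  exists2 g : {linear Z -> R^o}, continuous g & forall z, g z = psi (z - P z).
Proof.
move=> psic; elim=> [|f a Q fc Ma _ [g gc gE]].
  by exists psi => // z; rewrite subr0.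
have [h hE] : exists h : {linear Z -> R^o}, forall z, h z = g z - f z * psi a.
  apply: linear_fun_of => [x y|t x]; first by rewrite !linearD /=; ring.
  by rewrite !linearZ /= /GRing.scale /=; ring.
exists h => [z|z]; last first.
  have -> : z - (f z *: a + Q z) = (z - Q z) - f z *: a by lmodule R Z.
  by rewrite hE gE [RHS]linearB [X in _ = _ - X]linearZ.
have -> : (h : Z -> R^o) = (fun z => g z - f z * psi a) by apply/funext.
by apply: cvgB; [exact: gc|apply: cvgMl; exact: fc].
Qed.

(** Adjoining a vector [a] not fixed by the projection [P] built so far: a
    functional separating [a - P a] from [0], composed with [id - P], vanishes on
    the old span, so it provides the missing coordinate. *)
Lemma finite_rank_projection (s : seq Z) : hausdorff_space Z ->
  exists2 P, finite_rank (linear_hull [set` s]) P &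
    forall z, linear_hull [set` s] z -> P z = z.
Proof.
move=> hZ; elim: s => [|a s [P Pf Pid]].
  exists (fun=> 0) => [|z]; first exact: FiniteRank0.
  move=> /(_ [set 0]) <- //; split; last by move=> x /=; rewrite in_nil.
  by apply: subspaceP => // t x y -> ->; rewrite scaler0 addr0.
have sub : linear_hull [set` s] `<=` linear_hull [set` a :: s].
  by apply: linear_hull_mono => x /=; rewrite inE => ->; rewrite orbT.
have Pf' := finite_rank_mono sub Pf.
have [Pa|Pa] := eqVneq (a - P a) 0.
  exists P => // z /linear_hull_cons[c [w hw ->]].
  by rewrite (finite_rank_linear _ _ _ Pf) (Pid _ hw) -(subr0_eq Pa).
have [psi psic psi1] := separate_point hZ Pa.
have [g gc gE] := finite_rank_residual psic Pf.
exists (fun z => g z *: (a - P a) + P z).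
  apply: FiniteRankD => //; have Ss := @linear_hull_subspace _ _ [set` a :: s].
  apply: (subspaceD Ss); first by apply: sub_linear_hull; rewrite /= mem_head.
  by rewrite -scaleN1r; apply: (subspaceZ _ Ss); exact: finite_rank_mem Ss Pf'.
move=> z /linear_hull_cons[c [w hw ->]].
have -> : g (c *: a + w) = c.
  rewrite linearP /= !gE psi1 (Pid _ hw) subrr linear0 addr0.
  by rewrite /GRing.scale /= mulr1.
by rewrite (finite_rank_linear _ _ _ Pf) (Pid _ hw); lmodule R Z.
Qed.

(** Each summand is small with [z], hence lies in [B]; halving combines the
    summands by convexity. *)
Lemma finite_rank_nbhs M P (B : set Z) : linear_subspace M -> convex_set B ->
  (forall z, M z -> exists2 t : R, 0 < t & B (t *: z)) -> finite_rank M P ->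
  nbhs 0 [set z | B (P z)].
Proof.
move=> Ms Bcv Babs.
have B0 : B 0 by have [t _] := Babs _ (subspace0 Ms); rewrite scaler0.
elim=> [|f a Q fc Ma Qf IH]; first exact: filterE.
have [m m0 Bm] := Babs a Ma.
have [m' m'0 Bm'] := Babs _ (subspaceZ (-1) Ms Ma).
have fsmall : nbhs 0 [set z | `|f z| < Num.min m m' / 2].
  have : f @ (0 : Z) --> f 0 := fc 0.
  rewrite linear0 => /cvgrPdist_lt/(_ (Num.min m m' / 2)).
  have mm0 : 0 < Num.min m m' / 2 by rewrite divr_gt0 // lt_min m0.
  by move=> /(_ mm0); apply: filterS => z; rewrite /= sub0r normrN.
apply: filterS (filterI fsmall (nbhs0_scale 2 IH)) => z [/= fz Bz].
have -> : f z *: a + Q z = (1 / 2) *: ((2 * f z) *: a) + (1 - 1 / 2) *: Q (2 *: z).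
  have := finite_rank_linear 2 z 0 Qf; rewrite addr0 => ->.
  have -> : Q 0 = 0.
    have := finite_rank_linear 0 0 0 Qf; rewrite !scale0r !add0r => Q0.
    have := finite_rank_linear (-1) 0 0 Qf; rewrite addr0 scaler0.
    by rewrite scaleN1r addNr.
  by lmodule R Z; field.
move/convex_setP: (Bcv); apply => //; try lra.
have small (k : R) : 0 < k -> Num.min m m' <= k -> `|2 * f z| <= k.
  by move=> k0 mk; rewrite normrM ger0_norm //; lra.
have [f0|f0] := leP 0 (f z).
  have := small m m0; rewrite ge_min lexx => /(_ isT).
  rewrite ger0_norm ?mulr_ge0 // => fm.
  have -> : (2 * f z) *: a = (2 * f z / m) *: (m *: a) by lmodule R Z; field; lra.
  apply: convex_set_shrink => //; first by rewrite divr_ge0 ?mulr_ge0 // ltW.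
  by rewrite ler_pdivrMr // mul1r.
have := small m' m'0; rewrite ge_min lexx orbT => /(_ isT).
rewrite ltr0_norm ?pmulr_rlt0 // => fm.
have -> : (2 * f z) *: a = (- (2 * f z) / m') *: (m' *: (-1 *: a)).
  by lmodule R Z; field; lra.
apply: convex_set_shrink => //; first by rewrite divr_ge0 //; lra.
by rewrite ler_pdivrMr // mul1r.
Qed.

Lemma finite_dimensional_nbhs M (B : set Z) : hausdorff_space Z ->
  linear_subspace M -> finite_dimensional M -> convex_set B ->
  (forall z, M z -> exists2 t : R, 0 < t & B (t *: z)) ->
  within M (nbhs 0) B.
Proof.
move=> hZ Ms [A /finite_seqP[s ->] ME] Bcv Babs.
have [P Pf Pid] := finite_rank_projection s hZ.
rewrite -ME in Pf Pid.
have := finite_rank_nbhs Ms Bcv Babs Pf.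
by apply: filterS => z /= Bz Mz; rewrite -(Pid _ Mz).
Qed.

End finite_rank.

(** * The scalar multiplier *)

Lemma eq_pair (A B : Type) (p q : A * B) : p.1 = q.1 -> p.2 = q.2 -> p = q.
Proof. by case: p q => [a b] [c d] /= -> ->. Qed.

(** Read [P] as the epigraph of a convex function [v] on [M], at most [t0] on the
    trace on [M] of a convex symmetric neighbourhood [V], with [v 0 >= 0].
    Convexity along the line through [0] gives [v z >= - r * t0] when [z] lies in
    both [M] and [r V].  Hence the cone [W] spanned by [P], by [V] placed at
    height [t0], and by the upward vertical direction does not contain the
    downward one, and a functional positive on [W] and normalized on the vertical
    direction is [(z, t) |-> f z + t]. *)
Lemma multiplier {R : realType} {Z : tvsType R} (M : set Z) (P : set (Z * R^o))
    (t0 : R) :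
  linear_subspace M -> convex_set P -> (forall z t, P (z, t) -> M z) ->
  (forall t, P (0, t) -> 0 <= t) -> within M (nbhs 0) [set z | P (z, t0)] ->
  exists2 f : {linear Z -> R^o}, continuous f &
    forall z t, P (z, t) -> 0 <= f z + t.
Proof.
move=> Msub Pcv PM P0 Pt0.
have [V [V0 Vcv Vsym VP]] := nbhs0_convex_sym Pt0.
have V00 : V 0 by exact: nbhs_singleton.
have P0t0 : P (0, t0) by apply: VP => //; exact: subspace0.
have t00 := P0 _ P0t0.
pose W := [set p : Z * R^o | exists l q r v s, [/\ 0 <= l, P q, 0 <= r, V v &
  0 <= s /\ p = (l *: q.1 + r *: v, l * q.2 + r * t0 + s)]].
have [|||g gW g1] := @positive_functional R (Z * R^o)%type W (0, 1).
- split=> [t _ a0 [l [q [r [v [s [l0 Pq r0 Vv [s0 ->]]]]]]]|].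
    exists (t * l), q, (t * r), v, (t * s); split; rewrite ?mulr_ge0 //.
    split; rewrite ?mulr_ge0 //; apply: eq_pair => /=; first by lmodule R Z.
    by rewrite /= /GRing.scale /=; ring.
  move=> _ _ [l [q [r [v [s [l0 Pq r0 Vv [s0 ->]]]]]]]
             [l' [q' [r' [v' [s' [l0' Pq' r0' Vv' [s0' ->]]]]]]].
  have [q'' Pq'' qE] := convex_merge Pcv Pq Pq' l0 l0'.
  have [v'' Vv'' vE] := convex_merge Vcv Vv Vv' r0 r0'.
  exists (l + l'), q'', (r + r'), v'', (s + s'); split; rewrite ?addr_ge0 //.
  split; rewrite ?addr_ge0 //; apply: eq_pair => /=.
    rewrite -vE.
    have <- : l *: q.1 + l' *: q'.1 = (l + l') *: q''.1 := congr1 fst qE.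
    by lmodule R Z.
  have <- : l * q.2 + l' * q'.2 = (l + l') * q''.2 := congr1 snd qE.
  by ring.
- move=> [z t]; have [d d0 dV] := nbhs_scale_small z V0.
  (* The coefficient [c^-1] is small enough to leave a nonnegative height to the
     vertical part of the decomposition. *)
  pose c := 1 + `|t| + t0 / (d / 2).
  have td0 : 0 <= t0 / (d / 2) by rewrite divr_ge0 //; lra.
  have c0 : 0 < c by rewrite /c; have := normr_ge0 t; lra.
  exists c^-1; first by rewrite invr_gt0.
  exists 0, (0, t0), (c^-1 / (d / 2)), ((d / 2) *: z),
    (1 + c^-1 * t - c^-1 * (t0 / (d / 2))); split=> //.
  + by rewrite divr_ge0 ?invr_ge0 ?ltW //; lra.
  + by apply: dV; rewrite ger0_norm; lra.
  + split; last first.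
      apply: eq_pair => /=; first by lmodule R Z; field; lra.
      by rewrite /GRing.scale /=; field; lra.
    have -> : 1 + c^-1 * t - c^-1 * (t0 / (d / 2)) = c^-1 * (c + t - t0 / (d / 2)).
      by field; lra.
    rewrite mulr_ge0 ?invr_ge0 ?ltW // /c.
    by have := ler_norm (- t); rewrite normrN; lra.
- move=> [l [[z t] [r [v [s [l0 Pq r0 Vv [s0 [/= zv tE]]]]]]]].
  rewrite oppr0 in zv.
  have Mz := PM _ _ Pq.
  have [v' Pv' zv'] : exists2 v', P (v', t0) & l *: z + r *: v' = 0.
    have [r_0|rn0] := eqVneq r 0.
      by exists 0 => //; rewrite zv r_0 !scale0r.
    exists v => //; apply: VP => //.
    have -> : v = (- (l / r)) *: z.
      have -> : v = r^-1 *: (l *: z + r *: v) + (- (l / r)) *: z.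
        by lmodule R Z; field.
      by rewrite -zv; lmodule R Z.
    exact: subspaceZ.
  have [[z' t'] Pz' zE] := convex_merge Pcv Pq Pv' l0 r0.
  have lr : 0 < l + r.
    rewrite lt_neqAle addr_ge0 // andbT eq_sym; apply/eqP => lr0.
    have l_0 : l = 0 by lra.
    have r_0 : r = 0 by lra.
    by move: tE; rewrite l_0 r_0; lra.
  have z'0 : z' = 0.
    have -> : z' = (l + r)^-1 *: ((l + r) *: z') by lmodule R Z; field; lra.
    have <- : l *: z + r *: v' = (l + r) *: z' := congr1 fst zE.
    by rewrite zv' scaler0.
  have := P0 t'; rewrite -z'0 => /(_ Pz') t'0.
  have h : l * t + r * t0 = (l + r) * t' := congr1 snd zE.
  have : 0 <= (l + r) * t' by rewrite mulr_ge0 // ltW.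
  have -> : (l + r) * t' = l * t + r * t0 by [].
  by lra.
have gE z t : g (z, t) = g (z, 0) + t.
  have -> : (z, t) = (z, 0) + t *: (0, 1) :> Z * R^o.
    by apply: eq_pair; rewrite /= ?scaler0 ?addr0 // add0r /GRing.scale /= mulr1.
  by rewrite linearD linearZ /= g1 /GRing.scale /= mulr1.
have [f fE] : exists f : {linear Z -> R^o}, forall z, f z = g (z, 0).
  apply: linear_fun_of => [x y|t x].
    by rewrite -linearD; congr (g (_, _)); rewrite /= addr0.
  by rewrite -linearZ; congr (g (_, _)); rewrite /= scaler0.
exists f => [|z t Pzt].
  apply: (@functional_continuous _ _ _ (- t0)).
  apply: filterS V0 => v Vv /=; rewrite fE.
  suff : 0 <= g (v, t0) by rewrite gE; lra.
  apply: gW; exists 0, (0, t0), 1, v, 0; split; rewrite ?ler01 //.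
  by split=> //; apply: eq_pair => /=; [lmodule R Z|ring].
rewrite fE -gE; apply: gW; exists 1, (z, t), 0, 0, 0; split; rewrite ?ler01 //.
by split=> //; apply: eq_pair => /=; [lmodule R Z|ring].
Qed.

(** * Scalarization by a functional positive on a cone *)

Section cone_interior.
Context {R : realType} {Y : tvsType R} {K : set Y}.
Hypotheses (K_convex : convex_set K) (K_cone : is_cone K).

Lemma cone_add a b : K a -> K b -> K (a + b).
Proof.
move=> Ka Kb; have -> : a + b = 2 *: ((1 / 2) *: a + (1 - 1 / 2) *: b).
  by lmodule R Y; field.
by apply: K_cone => //; move/convex_setP: K_convex; apply=> //; lra.
Qed.

Lemma interior_cone_add a k : K° a -> K k -> K° (a + k).
Proof.
move=> /nbhs_translate Ka Kk; apply/nbhs_translate; apply: filterS Ka => z /= Kaz.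
have -> : a + k + z = (a + z) + k by lmodule R Y.
exact: cone_add.
Qed.

Lemma interior_cone_scale a (t : R) : 0 < t -> K° a -> K° (t *: a).
Proof.
move=> t0 /nbhs_translate Ka; apply/nbhs_translate.
apply: filterS (nbhs0_scale t^-1 Ka) => z /= Kaz.
have -> : t *: a + z = t *: (a + t^-1 *: z) by lmodule R Y; field; lra.
by apply: K_cone => //; exact: ltW.
Qed.

(** Separates [Q + K] from [- K°], through the cone spanned by [Q] and [K], which
    does not contain [- k0]. *)
Lemma cone_scalarization (Q : set Y) k0 : K° k0 -> Q !=set0 ->
  (forall a b (t : R), 0 <= t -> t <= 1 -> Q a -> Q b ->
    exists2 c, Q c & exists2 k, K k & t *: a + (1 - t) *: b = c + k) ->
  (forall a, Q a -> ~ K° (- a)) ->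
  exists f : {linear Y -> R^o}, [/\ continuous f, forall k, K k -> 0 <= f k,
    f k0 = 1 & forall a, Q a -> 0 <= f a].
Proof.
move=> Kk0 [q0 Qq0] Qcv QK.
have K0 : K 0 by have /(K_cone (lexx 0)) := interior_subset Kk0; rewrite scale0r.
pose W := [set w | exists l q k, [/\ 0 <= l, Q q, K k & w = l *: q + k]].
have WK k : K k -> W k by move=> Kk; exists 0, q0, k; rewrite scale0r add0r.
have [|||f fW f1] := @positive_functional R Y W k0.
- split=> [t _ t0 [l [q [k [l0 Qq Kk ->]]]]|].
    exists (t * l), q, (t *: k); split; rewrite ?mulr_ge0 //; last by lmodule R Y.
    exact: K_cone.
  move=> _ _ [l [q [k [l0 Qq Kk ->]]]] [l' [q' [k' [l0' Qq' Kk' ->]]]].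
  have QKcv : convex_set [set q + k | q in Q & k in K].
    apply/convex_setP => _ _ t t0 t1 [a Qa [ka Kka <-]] [b Qb [kb Kkb <-]].
    have [c Qc [k'' Kk'' E]] := Qcv a b t t0 t1 Qa Qb.
    exists c => //; exists (k'' + (t *: ka + (1 - t) *: kb)).
      by apply: cone_add => //; move/convex_setP: K_convex; exact.
    by rewrite addrA -E; lmodule R Y.
  have Q' a : Q a -> [set q + k | q in Q & k in K] a.
    by move=> Qa; exists a => //; exists 0; rewrite ?addr0.
  have [_ [c Qc [kc Kkc <-]] E] := convex_merge QKcv (Q' _ Qq) (Q' _ Qq') l0 l0'.
  exists (l + l'), c, ((l + l') *: kc + (k + k')); split=> //.
  + exact: addr_ge0.
  + by apply: cone_add; [apply: K_cone => //; exact: addr_ge0|exact: cone_add].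
  + have -> : (l + l') *: c + ((l + l') *: kc + (k + k')) =
              (l + l') *: (c + kc) + (k + k') by lmodule R Y.
    by rewrite -E; lmodule R Y.
- move=> x; have /nbhs_translate nK := Kk0.
  have [r r0 rK] := nbhs_scale_small x nK.
  by exists (r / 2); [lra|apply/WK/rK; rewrite ger0_norm; lra].
- move=> [l [q [k [l0 Qq Kk E]]]].
  have Kkk : K° (k0 + k) by exact: interior_cone_add.
  have [l_0|ln0] := eqVneq l 0.
    (* If [0] is interior to [K] then [K°] is the whole space. *)
    have {Kkk} Kn : K° 0.
      have <- : k0 + k = 0 by rewrite -[k0]opprK E l_0; lmodule R Y.
      exact: Kkk.
    have nK : nbhs 0 K°.
      by apply: open_nbhs_nbhs; split=> //; exact: open_interior.
    have [r r0 rK] := nbhs_scale_small (- q) nK.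
    apply: (QK _ Qq).
    have -> : - q = (r / 2)^-1 *: ((r / 2) *: - q) by lmodule R Y; field; lra.
    apply: interior_cone_scale; first by rewrite invr_gt0; lra.
    by apply: rK; rewrite ger0_norm; lra.
  apply: (QK _ Qq).
  have -> : - q = l^-1 *: (k0 + k).
    have -> : k0 + k = - (l *: q).
      have -> : k0 = - (l *: q + k) by rewrite -E opprK.
      by lmodule R Y.
    by lmodule R Y; field.
  by apply: interior_cone_scale Kkk; rewrite invr_gt0 lt_neqAle eq_sym ln0.
exists f; split=> // [|k /WK /fW //|a Qa]; last first.
  by apply: fW; exists 1, a, 0; rewrite scale1r addr0.
apply: (@functional_continuous _ _ _ (-1)).
have /nbhs_translate := Kk0; apply: filterS => z /= /WK /fW.
by rewrite linearD f1 /=; lra.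
Qed.

End cone_interior.
(** * The perturbed scalar problem *)

Section lagrange.
Context {R : realType} {X Y Z : tvsType R} (K : set Y) (S : set Z) (C : set X).
Context (F : X -> option Y) (G : X -> option Z) (L : {linear X -> Y}) (y : Y).
Context (h : {linear Y -> R^o}).
Hypotheses (S_convex : convex_set S) (S_cone : is_cone S).
Hypotheses (C_convex : convex_set C).
Hypotheses (F_convex : cone_convex K F) (G_convex : cone_convex S G).
Hypothesis h_ge0 : forall k, K k -> 0 <= h k.

(** Kept as a relation between decision, perturbation and cost because it is used
    in two ways: forgetting [x] gives the epigraph of the value function, and
    fixing [t] gives the closed convex graph to which the Robinson-Ursescu theorem
    applies. *)
Definition achieves x z (t : R) := exists v g s,
  [/\ C x, F x = Some v, G x = Some g, S s & z = g + s /\ h (v - L x + y) <= t].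

Definition value_epigraph : set (Z * R^o) :=
  [set p | exists x, achieves x p.1 p.2].

Let E := constraint_image C F G S.

Lemma epigraph_comb (V : lmodType R) (U : set V) (H : X -> option V) x x' v v'
    (t : R) :
  cone_convex U H -> U 0 -> 0 <= t -> t <= 1 -> H x = Some v -> H x' = Some v' ->
  exists2 w, H (t *: x + (1 - t) *: x') = Some w &
    exists2 u, U u & t *: v + (1 - t) *: v' = w + u.
Proof.
move=> /convex_setP Hcv U0 t0 t1 Hx Hx'.
have := Hcv (x, v) (x', v') t t0 t1 _ _.
case.
- by exists v, 0; rewrite addr0.
- by exists v', 0; rewrite addr0.
by move=> w [u [/= Hw Uu wu]]; exists w => //; exists u.
Qed.

Lemma achieves_mono x z t t' : t <= t' -> achieves x z t -> achieves x z t'.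
Proof.
move=> tt' [v [g [s [Cx Fx Gx Ss [zE ht]]]]]; exists v, g, s; split=> //.
by split=> //; exact: le_trans tt'.
Qed.

Lemma achieves_convex x x' z z' t t' (l : R) : K 0 -> 0 <= l -> l <= 1 ->
  achieves x z t -> achieves x' z' t' ->
  achieves (l *: x + (1 - l) *: x') (l *: z + (1 - l) *: z')
    (l * t + (1 - l) * t').
Proof.
move=> K0 l0 l1 [v [g [s [Cx Fx Gx Ss [-> ht]]]]]
  [v' [g' [s' [Cx' Fx' Gx' Ss' [-> ht']]]]].
have S0 : S 0 by have := S_cone (lexx 0) Ss; rewrite scale0r.
have [w Fw [k Kk wk]] := epigraph_comb F_convex K0 l0 l1 Fx Fx'.
have [c Gc [u Su cu]] := epigraph_comb G_convex S0 l0 l1 Gx Gx'.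
exists w, c, (u + (l *: s + (1 - l) *: s')); split=> //.
- by move/convex_setP: C_convex; exact.
- by apply: cone_add => //; move/convex_setP: S_convex; exact.
- split; first by rewrite addrA -cu; lmodule R Z.
  have -> : w - L (l *: x + (1 - l) *: x') + y =
     (l *: (v - L x + y) + (1 - l) *: (v' - L x' + y)) - k.
    have -> : w = l *: v + (1 - l) *: v' - k by rewrite wk addrK.
    by rewrite linearD !linearZ /=; lmodule R Y.
  rewrite [h (_ - k)]linearB [h (l *: _ + _)]linearD [h (l *: _)]linearZ
    [h ((1 - l) *: _)]linearZ.
  have hk := h_ge0 Kk; have ll := ler_wpM2l l0 ht.
  have l1' : 0 <= 1 - l by lra.
  have rr := ler_wpM2l l1' ht'.
  apply: le_trans (_ : l * h (v - L x + y) + (1 - l) * h (v' - L x' + y) <= _).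
    by rewrite gerBl.
  exact: lerD.
Qed.

Lemma value_epigraph_convex : K 0 -> convex_set value_epigraph.
Proof.
move=> K0; apply/convex_setP => -[z t] [z' t'] l l0 l1 [x /= xz] [x' /= xz'].
by exists (l *: x + (1 - l) *: x'); exact: achieves_convex.
Qed.

Lemma constraint_imageP z : E z <-> exists x t, achieves x z t.
Proof.
split=> [[g [x [[Cx Fx] Gx] xg] [s Ss <-]]|[x [t [v [g [s [Cx Fx Gx Ss [-> _]]]]]]]].
  case Fxv : (F x) Fx => [v|] // _.
  by exists x, (h (v - L x + y)), v, g, s.
exists g; first by exists x; rewrite // /edom /= Fx Gx.
by exists s.
Qed.

(** Moving towards a feasible point [x0] shrinks both the perturbation and the
    excess of the cost over [t0]. *)
Lemma value_absorbing (M : set Z) x0 (t0 : R) : K 0 -> achieves x0 0 t0 ->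
  (forall z, M z -> exists2 t : R, 0 < t & E (t *: z)) ->
  forall z, M z -> exists2 t : R, 0 < t & exists x, achieves x (t *: z) (t0 + 1).
Proof.
move=> K0 a0 Mabs z Mz; have [t t_gt0 /constraint_imageP[x [t' xa]]] := Mabs z Mz.
pose l := (1 + `|t'| + `|t0|)^-1.
have den : 0 < 1 + `|t'| + `|t0|.
  by have := normr_ge0 t'; have := normr_ge0 t0; lra.
have l0 : 0 < l by rewrite invr_gt0.
have l1 : l <= 1.
  by rewrite invf_le1 //; have := normr_ge0 t'; have := normr_ge0 t0; lra.
exists (l * t); first exact: mulr_gt0.
exists (l *: x + (1 - l) *: x0).
have -> : (l * t) *: z = l *: (t *: z) + (1 - l) *: 0 by lmodule R Z.
apply: achieves_mono (achieves_convex K0 (ltW l0) l1 xa a0).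
have : l * (t' - t0) <= 1.
  rewrite mulrC ler_pdivrMr // mul1r.
  by have := ler_norm t'; have := ler_norm (- t0); rewrite normrN; lra.
lra.
Qed.

Lemma value_nbhs_slater xbar : (C `&` edom F) xbar -> einset (setN S°) (G xbar) ->
  exists t1 : R, within setT (nbhs 0) [set z | value_epigraph (z, t1)].
Proof.
move=> [Cx Fx] [_ [s0 s0S <-] Gx]; case Fxv : (F xbar) Fx => [v|] // _.
exists (h (v - L xbar + y)).
have /nbhs_translate := s0S; apply: filterS => z /= Sz _.
exists xbar, v, (- s0), (s0 + z); split=> //; split=> //=.
by lmodule R Z.
Qed.

(** Lower semicontinuity makes the sublevel set of the cost closed, and the
    constraint is a membership in the closed epigraph of [G]. *)
Lemma achieves_closed (t1 : R) : continuous L -> continuous h -> closed C ->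
  lower_semicontinuous (scalarization h F) -> epi_closed S G ->
  closed [set p : X * Z | achieves p.1 p.2 t1].
Proof.
move=> Lc hc Ccl Flsc Gcl.
pose D := [set x | exists2 v, F x = Some v & h (v - L x + y) <= t1].
have Dcl : closed D.
  pose a x : R := t1 + h (L x) - h y.
  have ac : continuous (a : X -> R^o).
    move=> x; apply: cvgB; last exact: cvg_cst.
    apply: cvgD; first exact: cvg_cst.
    by apply: continuous_comp; [exact: Lc|exact: hc].
  have Da x v : F x = Some v -> (h (v - L x + y) <= t1) = (h v <= a x).
    move=> _; rewrite /a linearD linearB /=; apply/idP/idP; lra.
  (* A real strictly between the continuous bound and the scalarized value, so
     that both inequalities persist near [x]. *)
  have split_at x : ~ D x -> exists2 b, a x < b & (b%:E < scalarization h F x)%E.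
    rewrite /scalarization => Dx; case Fx : (F x) => [v|].
      exists ((a x + h v) / 2); last first; rewrite ?lte_fin.
        suff : a x < h v by lra.
        rewrite ltNge; apply/negP => hv; apply: Dx; exists v => //.
        by rewrite (Da _ _ Fx).
      suff : a x < h v by lra.
      rewrite ltNge; apply/negP => hv; apply: Dx; exists v => //.
      by rewrite (Da _ _ Fx).
    by exists (a x + 1); rewrite ?ltry //; lra.
  rewrite -[D]setCK; apply: open_closedC; rewrite openE => x Dx.
  have [b ab bF] := split_at x Dx.
  have [V xV Vb] := Flsc x b bF.
  have xa : nbhs x [set x' | a x' < b].
    exact: (cvgr_lt (a x) (ac x) b ab).
  apply: filterS (filterI xV xa) => x' [/Vb + ax'] [v Fx'].
  rewrite (Da _ _ Fx') /scalarization Fx' lte_fin; move: ax' => /=; lra.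
have -> : [set p : X * Z | achieves p.1 p.2 t1] =
    (fst @^-1` C `&` fst @^-1` D) `&` epigraph S G.
  apply/seteqP; split=> -[x z] /=.
    move=> [v [g [s [Cx Fx Gx Ss [zE ht]]]]]; split; first by split=> //; exists v.
    by exists g, s.
  move=> [[Cx [v Fx ht]] [g [s [/= Gx Ss zE]]]].
  by exists v, g, s.
have fc (A : set X) : closed A -> closed (fst @^-1` A : set (X * Z)).
  by move=> Acl; apply: closed_comp => // p _; exact: cvg_fst.
by apply: closedI => //; apply: closedI; exact: fc.
Qed.

End lagrange.

(** * The duality theorem *)

Theorem theorem4p3 (R : realType) (X Y Z : tvsType R)
  (hX : hausdorff_space X) (hY : hausdorff_space Y) (hZ : hausdorff_space Z)
  (K : set Y) (K_closed : closed K) (K_pointed : is_pointed K)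
  (K_convex : convex_set K) (K_cone : is_cone K) (K_int : K° !=set0)
  (S : set Z) (S_nonempty : S !=set0) (S_closed : closed S)
  (S_convex : convex_set S) (S_cone : is_cone S)
  (C : set X) (C_nonempty : C !=set0) (C_convex : convex_set C)
  (F : X -> option Y) (F_proper : proper F) (F_convex : cone_convex K F)
  (G : X -> option Z) (G_proper : proper G) (G_convex : cone_convex S G)
  (feasible : feasible_set C G S `&` edom F !=set0)
  (regularity :
    (exists xbar, (C `&` edom F) xbar /\ einset (setN S°) (G xbar)) \/
    ([/\ frechet_space X, frechet_space Z & closed C] /\
     [/\ forall ys : {linear Y -> R^o}, continuous ys ->
           lower_semicontinuous (scalarization ys F),
         epi_closed S G &
         sqri (constraint_image C F G S) 0]) \/
    (finite_dimensional (linear_hull (constraint_image C F G S)) /\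
     ri (constraint_image C F G S) 0))
  (L : {linear X -> Y}) (L_continuous : continuous L) (y : Y) :
  (forall x, C x -> einset (setN S) (G x) ->
     ~ einset (setN K°) (F x +^ Some (- L x) +^ Some y))
  <->
  (exists2 T : {linear Z -> Y}, positive_operators S K T &
     forall x, C x ->
       ~ einset (setN K°)
           (F x +^ linear_comp T G x +^ Some (- L x) +^ Some y)).
Proof.
have [k0 Kk0] := K_int.
have K0 : K 0 by have := K_cone 0 _ (lexx 0) (interior_subset Kk0); rewrite scale0r.
have S0 : S 0.
  by have [s Ss] := S_nonempty; have := S_cone 0 _ (lexx 0) Ss; rewrite scale0r.
split; last first.
  move=> [T [Tc TSK] bT] x Cx [_ [s Ss <-] Gx] FK; apply: (bT x Cx).
  rewrite /linear_comp -Gx.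
  case: (F x) FK => [v|] [_ [k Kk <-]] //= [kE].
  exists (- (k + T s)); first by exists (k + T s) => //;
    apply: interior_cone_add => //; apply: TSK; exists s.
  have -> : T (- s) = - T s by rewrite linearN.
  by rewrite opprD kE; congr Some; lmodule R Y.
move=> b1.
have [x0 [[Cx0 [_ [s0 Ss0 <-] Gx0]] Fx0]] := feasible.
case Fx0v : (F x0) Fx0 => [v0|] // _.
have [h [hc hK hk0 hQ]] : exists h : {linear Y -> R^o}, [/\ continuous h,
    forall k, K k -> 0 <= h k, h k0 = 1 &
    forall x v, C x -> einset (setN S) (G x) -> F x = Some v ->
      0 <= h (v - L x + y)].
  pose Q := [set a | exists x v, [/\ C x, einset (setN S) (G x), F x = Some v &
    a = v - L x + y]].
  have [|||h [hc hK hk0 hQ]] :=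
      @cone_scalarization R Y K K_convex K_cone Q k0 Kk0.
  - exists (v0 - L x0 + y), x0, v0; split=> //; rewrite -Gx0.
    by exists (- s0) => //; exists s0.
  - move=> _ _ l l0 l1 [x [v [Cx [_ [s Ss <-] Gx] Fx ->]]]
      [x' [v' [Cx' [_ [s' Ss' <-] Gx'] Fx' ->]]].
    have [w Fw [k Kk wk]] := epigraph_comb F_convex K0 l0 l1 Fx Fx'.
    have [c Gc [u Su cu]] :=
      epigraph_comb G_convex S0 l0 l1 (esym Gx) (esym Gx').
    exists (w - L (l *: x + (1 - l) *: x') + y).
      exists (l *: x + (1 - l) *: x'), w; split=> //.
        by move/convex_setP: C_convex; exact.
      rewrite Gc; exists c => //; exists (l *: s + (1 - l) *: s' + u).
        by apply: cone_add => //; move/convex_setP: S_convex; exact.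
      have -> : c = l *: - s + (1 - l) *: - s' - u by rewrite cu addrK.
      by lmodule R Z.
    exists k => //; have -> : w = l *: v + (1 - l) *: v' - k by rewrite wk addrK.
    by rewrite [L (_ + _)]linearD [L (l *: _)]linearZ
      [L ((1 - l) *: _)]linearZ /=; lmodule R Y.
  - move=> _ [x [v [Cx Sx Fx ->]]] Ka; apply: (b1 x Cx Sx); rewrite Fx /=.
    exists (v - L x + y) => //; exists (- (v - L x + y)) => //.
    by rewrite opprK.
  exists h; split=> // x v Cx Sx Fx; apply: hQ; by exists x, v.
(* The functional [h] is nonnegative and nonzero, so it is positive on [K°]. *)
have hKint k : K° k -> 0 < h k.
  move=> /nbhs_translate/(nbhs_scale_small (- k0))[r r0 rK].
  have /rK/hK : `|r / 2| < r by rewrite ger0_norm; lra.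
  have -> : h (k + (r / 2) *: - k0) = h k - r / 2.
    by rewrite linearD functionalZ linearN hk0 mulrN1.
  by lra.
(* A bound on the value function near [0] in [M] suffices; the regularity
   conditions only enter to provide it. *)
have operator_of_bound (M : set Z) t1 : linear_subspace M ->
    (forall z, constraint_image C F G S z -> M z) ->
    within M (nbhs 0) [set z | value_epigraph S C F G L y h (z, t1)] ->
    exists2 T : {linear Z -> Y}, positive_operators S K T &
     forall x, C x ->
       ~ einset (setN K°)
           (F x +^ linear_comp T G x +^ Some (- L x) +^ Some y).
  move=> Ms EM nb.
  have [|||f fc fP] := multiplier Ms _ _ _ nb.
  - exact: (value_epigraph_convex S_convex S_cone C_convex F_convex G_convex hK K0).
  - by move=> z t [x xzt]; apply: EM;
      apply/(constraint_imageP S C F G L y h); exists x, t.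
  - move=> t [x [v [g [s [Cx Fx Gx Ss /= [gs ht]]]]]].
    apply: le_trans ht; apply: hQ => //; rewrite Gx; exists g => //; exists s => //.
    by rewrite -[g](addrK s) -gs sub0r.
  have fS s : S s -> 0 <= f s.
    move=> Ss; rewrite leNgt; apply/negP => fs0.
    (* If [f s < 0], a perturbation [n *: s], reached by [x0] at the fixed cost
       [c], would make [f (n *: s) + c] negative. *)
    pose c : R := h (v0 - L x0 + y); pose n : R := (1 + `|c|) / - f s.
    have n0 : 0 <= n.
      by apply: divr_ge0; [have := normr_ge0 c; lra|lra].
    have /fP : value_epigraph S C F G L y h (n *: s, c).
      exists x0, v0, (- s0), (s0 + n *: s); split=> //=.
        by apply: cone_add => //; exact: S_cone.
      by split=> //; lmodule R Z.
    rewrite functionalZ.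
    have -> : n * f s = - (1 + `|c|).
      by rewrite /n -{2}[f s]opprK mulrN divfK // oppr_eq0 lt_eqF.
    by have := ler_norm c; lra.
  have [T TE] : exists T : {linear Z -> Y}, forall z, T z = f z *: k0.
    apply: linear_fun_of => [z z'|t z]; first by rewrite linearD scalerDl.
    by rewrite linearZ scalerA.
  exists T.
    split; last first.
      move=> _ [s Ss <-]; rewrite TE; apply: K_cone; first exact: fS.
      exact: interior_subset Kk0.
    have -> : (T : Z -> Y) = (fun z => f z *: k0) by apply/funext.
    move=> z; apply: (@continuous_comp _ _ _ (fun z => (f z, k0))
      (fun p : R^o * Y => p.1 *: p.2)); last exact: scale_continuous.
    apply: (@cvg_pair _ _ _ _ (nbhs (f z)) (nbhs k0)); last exact: cvg_cst.
    exact: fc.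
  move=> x Cx; rewrite /linear_comp.
  case Gx : (G x) => [g|]; case Fx : (F x) => [v|] /= [_ [k Kk <-]] //= [kE].
  have : 0 <= f g + h (v - L x + y).
    by apply: fP; exists x, v, g, 0; split=> //=; rewrite addr0.
  have : h (v - L x + y) + f g = - h k.
    have -> : f g = h (T g) by rewrite TE functionalZ hk0 mulr1.
    transitivity (h (v - L x + y + T g)); first by rewrite [RHS]linearD.
    transitivity (h (- k)); last by rewrite [LHS]linearN.
    have kE' : - k = v + T g - L x + y := kE.
    by congr (h _); rewrite kE'; lmodule R Y.
  by have := hKint k Kk; lra.
case: regularity => [[xbar [CFx Gxb]]|
  [[[fX fZ Ccl] [Flsc Gcl [E0 Ecl Esub]]]|[Efin [E0 Eri]]]].
- have [t1 nb] := value_nbhs_slater L y h CFx Gxb.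
  by apply: operator_of_bound nb => //; apply: subspaceP.
- set E := constraint_image C F G S in E0 Ecl Esub operator_of_bound *.
  have EM : E `<=` cone_at E 0.
    by move=> z Ez; exists 1; rewrite /= ?ler01 //; exists z; rewrite // subr0 scale1r.
  apply: (operator_of_bound (cone_at E 0) (h (v0 - L x0 + y) + 1) Esub EM).
  have x0a : achieves S C F G L y h x0 0 (h (v0 - L x0 + y)).
    by exists v0, (- s0), s0; split=> //; rewrite addNr; split.
  have Eabs z : cone_at E 0 z -> exists2 t : R, 0 < t & E (t *: z).
    move=> [l /= l0 [e Ee <-]]; have [l_0|ln0] := eqVneq l 0.
      by exists 1; rewrite // l_0 scale0r scaler0.
    exists l^-1; first by rewrite invr_gt0 lt_neqAle eq_sym ln0.
    by rewrite scalerA mulVf // scale1r subr0.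
  pose Gam := [set p : X * Z | achieves S C F G L y h p.1 p.2
    (h (v0 - L x0 + y) + 1)].
  apply: (@robinson_ursescu R X Z Gam _ x0) => //.
  - by apply: achieves_closed => //; exact: Flsc.
  - apply/convex_setP => -[x z] [x' z'] l l0 l1 xz xz'.
    have := achieves_convex S_convex S_cone C_convex F_convex G_convex hK K0 l0 l1
      xz xz'.
    by apply: achieves_mono; lra.
  - by move=> x z xz; apply: EM;
      apply/(constraint_imageP S C F G L y h); exists x, (h (v0 - L x0 + y) + 1).
  - by apply: achieves_mono x0a; lra.
  - exact: (value_absorbing S_convex S_cone C_convex F_convex G_convex hK K0 x0a
      Eabs).
- set E := constraint_image C F G S in E0 Efin Eri operator_of_bound *.
  have Ms := @linear_hull_subspace _ _ E.
  apply: (operator_of_bound (linear_hull E) (h (v0 - L x0 + y) + 1) Ms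
    (@sub_linear_hull _ _ E)).
  have x0a : achieves S C F G L y h x0 0 (h (v0 - L x0 + y)).
    by exists v0, (- s0), s0; split=> //; rewrite addNr; split.
  apply: finite_dimensional_nbhs => //.
    apply/convex_setP => z z' l l0 l1 [x xz] [x' xz'].
    exists (l *: x + (1 - l) *: x').
    have := achieves_convex S_convex S_cone C_convex F_convex G_convex hK K0 l0 l1
      xz xz'.
    by apply: achieves_mono => /=; lra.
  apply: (value_absorbing S_convex S_cone C_convex F_convex G_convex hK K0 x0a).
  move=> z hz; have [r r0 rE] := nbhs_scale_small z Eri.
  exists (r / 2); first lra.
  apply: rE; first by rewrite ger0_norm; lra.
  by apply: (linear_hull_sub_affine E0); exact: (subspaceZ _ Ms).
Qed.
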